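(* Let $\Omega$ be an infinite compact Hausdorff space, let $X$ be a (real or complex) Banach space such that $X^*$ has the Radon--Nikodym Property, and let $F\in C(\Omega,X)^*$, identified with an $X^*$-valued regular Borel measure of bounded variation on $\Omega$ with total variation $|F|$. If $h:\Omega\to X^*$ is the Radon--Nikodym derivative of $F$ with respect to $|F|$ (i.e. $F=h\,d|F|$), then $F(f)=\int_\Omega h(\omega)(f(\omega))\,d|F|(\omega)$ for all $f\in C(\Omega,X)$.
   Context: $C(\Omega,X)$ is the Banach space of continuous functions $\Omega\to X$ with the supremum norm. Its dual is identified isometrically with $M(\Omega,X^* )$, the space of $X^*$-valued regular Borel measures of bounded variation with the total variation norm; under this identification, for $x\in X$ and scalar $f\in C(\Omega)$, with $(x\otimes f)(\omega)=f(\omega)x$, one has $F(x\otimes f)=\int f\,d(x\otimes F)$, where $x\otimes F$ is the scalar measure $(x\otimes F)(A)=F(A)(x)$ for Borel $A\subseteq\Omega$. The notation $F=h\,d|F|$ means that $h$ is Bochner integrable with respect to $|F|$ and $F(E)=\int_E h\,d|F|$ for every Borel set $E\subseteq\Omega$. *)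

(* Defs.v *)
From HB Require Import structures.
From mathcomp Require Import all_boot all_order all_algebra.
From mathcomp Require Import all_classical all_reals all_analysis.
From mathcomp Require Import complex.
Set Implicit Arguments.
Unset Strict Implicit.
Unset Printing Implicit Defensive.
Import Order.TTheory GRing.Theory Num.Theory.
Import numFieldNormedType.Exports.
Local Open Scope classical_set_scope.
Local Open Scope ring_scope.

Variant base_field := RealField | ComplexField.

Definition field_of (R : realType) (b : base_field) : numFieldType :=
  match b with RealField => R | ComplexField => R[i] end.

Section base_field.
Variables (R : realType) (b : base_field).
Local Notation K := (field_of R b).

Definition ofR : R -> K :=
  match b return R -> field_of R b with
  | RealField => fun r => r
  | ComplexField => fun r => Complex r 0
  end.

Definition reK : K -> R :=
  match b return field_of R b -> R with
  | RealField => fun z => z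
  | ComplexField => fun z => complex.Re z
  end.

Definition imK : K -> R :=
  match b return field_of R b -> R with
  | RealField => fun=> 0
  | ComplexField => fun z => complex.Im z
  end.

Definition mkK : R -> R -> K :=
  match b return R -> R -> field_of R b with
  | RealField => fun x _ => x
  | ComplexField => fun x y => Complex x y
  end.

Lemma ofRK : cancel ofR reK. Proof. by rewrite /ofR /reK; case: b. Qed.

Lemma ofRD x y : ofR (x + y) = ofR x + ofR y.
Proof.
rewrite /ofR; case: b => //=.
exact: (rmorphD (real_complex R)).
Qed.

Lemma ofRM x y : ofR (x * y) = ofR x * ofR y.
Proof.
rewrite /ofR; case: b => //=.
exact: (rmorphM (real_complex R)).
Qed.

Lemma ler_ofR x y : (ofR x <= ofR y) = (x <= y).
Proof. by rewrite /ofR; case: b => //=; rewrite lecR. Qed.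

Lemma ltr_ofR x y : (ofR x < ofR y) = (x < y).
Proof. by rewrite /ofR; case: b => //=; rewrite ltcR. Qed.

Lemma ofR0 : ofR 0 = 0. Proof. by rewrite /ofR; case: b. Qed.

Lemma normK_ofR (z : K) : `|z| = ofR (reK `|z|).
Proof. by rewrite /ofR /reK; case: b z => //= z; rewrite normc_def. Qed.
End base_field.

Section real_norm.
Variables (R : realType) (b : base_field).
Local Notation K := (field_of R b).

(* The library norm of a K-normed space is K-valued; rnorm is the real number
   it stands for. *)
Definition rnorm (V : normedModType K) (x : V) : R := reK `|x|.

Lemma rnormE (V : normedModType K) (x : V) : `|x| = ofR b (rnorm x).
Proof. by rewrite -[LHS]normr_id normK_ofR normr_id. Qed.

Lemma rnorm_ge0 (V : normedModType K) (x : V) : 0 <= rnorm x.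
Proof. by rewrite -(ler_ofR b) -rnormE ofR0. Qed.

Lemma rnorm0 (V : normedModType K) : rnorm (0 : V) = 0.
Proof. by rewrite /rnorm normr0 /reK; case: b. Qed.

Lemma rnorm_eq0 (V : normedModType K) (x : V) : rnorm x = 0 -> x = 0.
Proof.
move=> x0; by apply/eqP; rewrite -normr_eq0 rnormE x0 ofR0.
Qed.

Lemma ler_rnormD (V : normedModType K) (x y : V) :
  rnorm (x + y) <= rnorm x + rnorm y.
Proof. by rewrite -(ler_ofR b) ofRD -!rnormE ler_normD. Qed.

Lemma rnormZ (V : normedModType K) (a : K) (x : V) :
  rnorm (a *: x) = reK `|a| * rnorm x.
Proof. by rewrite /rnorm normrZ normK_ofR rnormE -ofRM !ofRK. Qed.

Definition supnorm (I : Type) (V : normedModType K) (A : set I) (f : I -> V) :=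
  sup [set rnorm (f i) | i in A].

Definition bounded_on (I : Type) (V : normedModType K) (A : set I)
    (f : I -> V) :=
  has_ubound [set rnorm (f i) | i in A].

Section supnorm.
Variables (I : Type) (V : normedModType K) (A : set I).
Implicit Types f g : I -> V.

Lemma ler_supnorm f i : bounded_on A f -> A i -> rnorm (f i) <= supnorm A f.
Proof. by move=> fb Ai; apply: ub_le_sup => //; exists i. Qed.

Lemma supnorm_le f (M : R) : 0 <= M ->
  (forall i, A i -> rnorm (f i) <= M) -> supnorm A f <= M.
Proof.
move=> M0 fM; have [->|A0] := eqVneq A set0.
  by rewrite /supnorm image_set0 sup0.
apply: sup_le_ub; first by have /set0P[i Ai] := A0; exists (rnorm (f i)), i.
by move=> _ [i Ai <-]; exact: fM.
Qed.

Lemma supnorm_ge0 f : 0 <= supnorm A f.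
Proof.
have [fb|fnb] := pselect (has_sup [set rnorm (f i) | i in A]); last first.
  by rewrite /supnorm sup_out.
have [[_ [i Ai _]] ub] := fb.
exact: (le_trans (rnorm_ge0 (f i)) (ler_supnorm ub Ai)).
Qed.

Lemma ler_supnormD f g : bounded_on A f -> bounded_on A g ->
  supnorm A (f + g) <= supnorm A f + supnorm A g.
Proof.
move=> fb gb; apply: supnorm_le; first by rewrite addr_ge0 ?supnorm_ge0.
move=> i Ai; apply: (le_trans (ler_rnormD _ _)).
by apply: lerD; apply: ler_supnorm.
Qed.

Lemma bounded_onZ (a : K) f : bounded_on A f -> bounded_on A (a *: f).
Proof.
move=> [M fM]; exists (reK `|a| * M) => _ [i Ai <-].
rewrite [(a *: f) i]/(a *: f i) rnormZ ler_wpM2l//.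
  exact: (@rnorm_ge0 K^o a).
by apply: fM; exists i.
Qed.

Lemma ler_supnormZ (a : K) f : bounded_on A f ->
  supnorm A (a *: f) <= reK `|a| * supnorm A f.
Proof.
move=> fb; have a0 : 0 <= reK `|a| by exact: (@rnorm_ge0 K^o a).
apply: supnorm_le; first by rewrite mulr_ge0 ?supnorm_ge0.
move=> i Ai; rewrite [(a *: f) i]/(a *: f i) rnormZ ler_wpM2l//.
exact: ler_supnorm.
Qed.

Lemma supnormZ (a : K) f : bounded_on A f ->
  supnorm A (a *: f) = reK `|a| * supnorm A f.
Proof.
move=> fb; apply/eqP; rewrite eq_le ler_supnormZ//=.
have [->|a0] := eqVneq a 0.
  by rewrite [reK _](@rnorm0 K^o) mul0r supnorm_ge0.
have := ler_supnormZ a^-1 (bounded_onZ a fb).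
rewrite scalerA mulVf// scale1r => fa.
have ar : reK `|a| * reK `|a^-1| = 1.
  have e : a *: (a^-1 : K^o) = 1 by exact: mulfV.
  have := rnormZ a (a^-1 : K^o); rewrite e {2}/rnorm => <-.
  by rewrite /rnorm normr1 /reK; case: (b).
apply: (le_trans (ler_wpM2l _ fa)); first exact: (@rnorm_ge0 K^o a).
by rewrite mulrA ar mul1r.
Qed.

End supnorm.
End real_norm.

Section dual.
Variables (R : realType) (b : base_field).
Local Notation K := (field_of R b).
Variable V : normedModType K.

Definition dual_pred : {pred V -> K^o} :=
  fun f => `[< linear f /\ continuous f >].

Record dual := Dual {
  dual_fun :> V -> K^o;
  dual_subproof : dual_fun \in dual_pred }.

HB.instance Definition _ := [isSub for dual_fun].
HB.instance Definition _ := [Choice of dual by <:].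

Fact dual_submod_closed : subsemimod_closed dual_pred.
Proof.
apply: GRing.submod_closed_semi; split.
  apply/asboolP; split; last exact: cst_continuous.
  by move=> a u v; rewrite scaler0 addr0.
move=> a f g /asboolP[fl fc] /asboolP[gl gc]; apply/asboolP; split.
  move=> c u v.
  change (a * f (c *: u + v) + g (c *: u + v) =
          c * (a * f u + g u) + (a * f v + g v)).
  by rewrite fl gl !mulrDr mulrCA addrACA.
move=> x; apply: continuousD; last exact: gc.
by apply: continuousZr; exact: fc.
Qed.

HB.instance Definition _ := GRing.isSubmodClosed.Build K (V -> K^o) dual_pred
  dual_submod_closed.
HB.instance Definition _ := [SubChoice_isSubLmodule of dual by <:].

Lemma dual_linear (f : dual) : linear f.
Proof. by case: f => f /= /asboolP[]. Qed.

Lemma dual_continuous (f : dual) : continuous f.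
Proof. by case: f => f /= /asboolP[]. Qed.


HB.instance Definition _ (f : dual) :=
  GRing.isLinear.Build K V K^o *:%R (dual_fun f) (dual_linear f).

Definition closed_unit_ball : set V := [set x | `|x| <= 1].

Definition dual_norm (f : dual) : K := ofR b (supnorm closed_unit_ball f).

Lemma dual_bounded (f : dual) : bounded_on closed_unit_ball f.
Proof.
have /linear_bounded_continuous/linear_boundedP fb := @dual_continuous f.
have /pinfty_ex_gt0[r r0 fr] := fb.
have rK : ofR b (reK r) = r by rewrite -(gtr0_norm r0) -normK_ofR.
exists (reK r) => _ [x x1 <-]; rewrite -(ler_ofR b) -rnormE rK.
by apply: le_trans (fr x) _; rewrite ler_piMr// ltW.
Qed.

Fact dual_normD f g : dual_norm (f + g) <= dual_norm f + dual_norm g.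
Proof.
by rewrite /dual_norm -ofRD ler_ofR; apply: ler_supnormD; exact: dual_bounded.
Qed.

Fact dual_normZ (a : K) f : dual_norm (a *: f) = `|a| * dual_norm f.
Proof.
by rewrite /dual_norm normK_ofR -ofRM -supnormZ//; exact: dual_bounded.
Qed.

Fact dual_norm_eq0 f : dual_norm f = 0 -> f = 0.
Proof.
move=> f0; apply/val_inj/funext => x /=.
have {}f0 : supnorm closed_unit_ball f = 0.
  by rewrite -[LHS](ofRK b) -/(dual_norm f) f0 /reK; case: (b).
have [->|x0] := eqVneq x 0; first exact: linear0.
have nx0 : `|x| != 0 by rewrite normr_eq0.
have : f (`|x|^-1 *: x) = 0.
  apply/(@rnorm_eq0 _ _ K^o)/eqP; rewrite eq_le rnorm_ge0 andbT -[leRHS]f0.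
  apply: ler_supnorm; first exact: dual_bounded.
  by rewrite /closed_unit_ball /= normrZ normfV normr_id mulVf.
rewrite linearZ/= => /eqP; rewrite scaler_eq0 invr_eq0 (negPf nx0) /=.
by move=> /eqP.
Qed.

HB.instance Definition _ := Lmodule_isNormed.Build K dual
  dual_normD dual_normZ dual_norm_eq0.

End dual.


Definition cspace_pred (Omega V : topologicalType) : {pred Omega -> V} :=
  fun f => `[< continuous f >].

(* The compactness proof is only a parameter: it makes the sup norm well defined. *)
Record cspace (R : realType) (b : base_field) (Omega : topologicalType)
    (Omega_compact : compact [set: Omega]) (V : normedModType (field_of R b)) :=
  Cspace { cspace_fun :> Omega -> V;
           cspace_subproof : cspace_fun \in @cspace_pred Omega V }.

Section cspace.
Variables (R : realType) (b : base_field).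
Local Notation K := (field_of R b).
Variables (Omega : topologicalType) (Omega_compact : compact [set: Omega]).
Variable V : normedModType K.
Local Notation C := (cspace Omega_compact V).

HB.instance Definition _ := [isSub for @cspace_fun R b Omega Omega_compact V].
HB.instance Definition _ := [Choice of C by <:].

Fact cspace_submod_closed : subsemimod_closed (@cspace_pred Omega V).
Proof.
apply: GRing.submod_closed_semi; split.
  by apply/asboolP; exact: cst_continuous.
move=> a f g /asboolP fc /asboolP gc; apply/asboolP => x.
by apply: continuousD; [apply: continuousZr; exact: fc|exact: gc].
Qed.

HB.instance Definition _ := GRing.isSubmodClosed.Build K (Omega -> V) (@cspace_pred Omega V)
  cspace_submod_closed.
HB.instance Definition _ := [SubChoice_isSubLmodule of C by <:].

Lemma cspace_continuous (f : C) : continuous f.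
Proof. by case: f => f /= /asboolP. Qed.

Definition cspace_norm (f : C) : K := ofR b (supnorm setT f).

Lemma cspace_bounded (f : C) : bounded_on setT f.
Proof.
have [E0|/set0P E0] := eqVneq [set: Omega] set0.
  by exists 0 => r [x _ _]; have : set0 x by rewrite -E0.
have rfc : continuous (fun w => rnorm (f w)).
  move=> w; apply/cvgrPdist_lt => e e0.
  have e0' : 0 < ofR b e by rewrite -(ofR0 R b) ltr_ofR.
  have /cvgrPdist_lt/(_ _ e0') fe := @cspace_continuous f w.
  apply: filterS fe => w'.
  rewrite rnormE ltr_ofR; apply: le_lt_trans.
  rewrite ler_norml lerNl opprB !lerBlDr; apply/andP; split.
    by rewrite -{1}(subrK (f w) (f w')) /rnorm distrC ler_rnormD.
  by rewrite -{1}(subrK (f w') (f w)) ler_rnormD.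
have [c _ fc] := compact_EVT_max E0 Omega_compact
  (continuous_subspaceT rfc).
by exists (rnorm (f c)) => _ [x _ <-]; apply: fc; rewrite inE.
Qed.

Fact cspace_normD f g : cspace_norm (f + g) <= cspace_norm f + cspace_norm g.
Proof.
by rewrite /cspace_norm -ofRD ler_ofR; apply: ler_supnormD; exact: cspace_bounded.
Qed.

Fact cspace_normZ (a : K) f : cspace_norm (a *: f) = `|a| * cspace_norm f.
Proof.
by rewrite /cspace_norm normK_ofR -ofRM -supnormZ//; exact: cspace_bounded.
Qed.

Fact cspace_norm_eq0 f : cspace_norm f = 0 -> f = 0.
Proof.
move=> f0; apply/val_inj/funext => x /=.
have {}f0 : supnorm setT f = 0.
  by rewrite -[LHS](ofRK b) -/(cspace_norm f) f0 /reK; case: (b).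
apply/rnorm_eq0/eqP; rewrite eq_le rnorm_ge0 andbT -[leRHS]f0.
by apply: ler_supnorm => //; exact: cspace_bounded.
Qed.

HB.instance Definition _ := Lmodule_isNormed.Build K C
  cspace_normD cspace_normZ cspace_norm_eq0.

End cspace.

Section tensor.
Variables (R : realType) (b : base_field).
Local Notation K := (field_of R b).
Variables (Omega : topologicalType) (Omega_compact : compact [set: Omega]).
Variable V : normedModType K.

Fact tensor_subproof (x : V) (f : cspace Omega_compact K^o) :
  (fun w => f w *: x) \in @cspace_pred Omega V.
Proof.
apply/asboolP => w; apply: (@continuousZl K V Omega (f : Omega -> K^o)).
exact: cspace_continuous.
Qed.

Definition tensor (x : V) (f : cspace Omega_compact K^o) :
    cspace Omega_compact V :=
  Cspace Omega_compact (tensor_subproof x f).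

End tensor.

Section vector_measure.
Variables (R : realType) (b : base_field).
Local Notation K := (field_of R b).
Context d (T : measurableType d) (V : normedModType K).

Definition vector_measure (F : set T -> V) :=
  forall A : nat -> set T, (forall n, measurable (A n)) -> trivIset setT A ->
  \sum_(0 <= i < n) F (A i) @[n --> \oo] --> F (\bigcup_i A i).

(* Supremum over finite families of disjoint measurable subsets of A; for
   measurable A this is the supremum over finite measurable partitions. *)
Definition measure_variation (F : set T -> V) (A : set T) : \bar R :=
  ereal_sup [set s | exists n (P : 'I_n -> set T),
    [/\ forall i, measurable (P i), forall i, P i `<=` A, trivIset setT P &
        s = (\sum_(i < n) rnorm (F (P i)))%:E]].

Definition simple_fun (s : T -> V) :=
  finite_set (range s) /\ forall v, measurable (s @^-1` [set v]).

Definition simple_int (mu : set T -> \bar R) (A : set T) (s : T -> V) : V :=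
  \sum_(v \in range s) ofR b (fine (mu (A `&` s @^-1` [set v]))) *: v.

(* Here and below mu is a finite measure, given by its underlying set function
   so that the notions apply directly to a variation. Convergence is only
   required almost everywhere; the library integral of a nonnegative function is
   a supremum over simple functions below it, hence the integrals of norms
   below are the expected ones even if f is measurable only up to a null set. *)
Definition strongly_measurable (mu : set T -> \bar R) (f : T -> V) :=
  exists s : nat -> T -> V, (forall n, simple_fun (s n)) /\
    {ae mu, forall x, s n x @[n --> \oo] --> f x}.

Definition L1_approx (mu : set T -> \bar R) (f : T -> V) (s : nat -> T -> V) :=
  (forall n, simple_fun (s n)) /\
  (\int[mu]_x (rnorm (f x - s n x))%:E)%E @[n --> \oo] --> 0%E.

Definition bochner_integrable (mu : set T -> \bar R) (f : T -> V) :=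
  strongly_measurable mu f /\ exists s, L1_approx mu f s.

(* The limit does not depend on the approximating sequence; the default 0 is
   only taken when f is not Bochner integrable. *)
Definition bochner_int (mu : set T -> \bar R) (A : set T) (f : T -> V) : V :=
  xget 0 [set y | exists2 s, L1_approx mu f s &
                  simple_int mu A (s n) @[n --> \oo] --> y].

Definition has_density (F : set T -> V) (h : T -> V) (mu : set T -> \bar R) :=
  bochner_integrable mu h /\ forall E, measurable E -> F E = bochner_int mu E h.

End vector_measure.

Definition RNP (R : realType) (b : base_field) (V : normedModType (field_of R b)) :=
  forall (d : measure_display) (T : measurableType d)
    (mu : {finite_measure set T -> \bar R}) (G : set T -> V),
  vector_measure G -> (measure_variation G setT < +oo)%E ->
  (forall A, measurable A -> mu A = 0%E -> G A = 0) ->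
  exists g, has_density G g mu.

Section scalar_integrals.
Variables (R : realType) (b : base_field).
Local Notation K := (field_of R b).
Context d (T : measurableType d).

(* Lebesgue integral of a K-valued function, by real and imaginary parts. *)
Definition scalar_int (mu : set T -> \bar R) (D : set T) (g : T -> K^o) : K^o :=
  mkK b (fine (\int[mu]_(x in D) (reK (g x))%:E)%E)
        (fine (\int[mu]_(x in D) (imK (g x))%:E)%E).

Definition simple_int_against (nu : set T -> K^o) (s : T -> K^o) : K^o :=
  \sum_(c \in range s) c * nu (s @^-1` [set c]).

(* Integral of a bounded measurable scalar function against a K-valued measure
   of bounded variation, as a limit along uniform simple approximations. *)
Definition int_against (nu : set T -> K^o) (f : T -> K^o) : K^o :=
  xget 0 [set y | exists s : nat -> T -> K^o,
    [/\ forall n, simple_fun (s n), {uniform, s @ \oo --> f} &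
        simple_int_against nu (s n) @[n --> \oo] --> y]].

End scalar_integrals.

Definition borel (Omega : ptopologicalType) := g_sigma_algebraType (@open Omega).

Section borel.
Variables (R : realType) (b : base_field).
Local Notation K := (field_of R b).
Variable Omega : ptopologicalType.

Definition regular (V : normedModType K) (F : set (borel Omega) -> V) :=
  forall (E : set (borel Omega)) (e : R), measurable E -> 0 < e ->
  exists C U : set Omega,
    [/\ compact C, open U, C `<=` E, E `<=` U &
        (measure_variation F (U `\` C) < e%:E)%E].

Definition regular_bv_measure (V : normedModType K)
    (F : set (borel Omega) -> V) :=
  [/\ vector_measure F, (measure_variation F setT < +oo)%E & regular F].

Definition tensor_measure (X : normedModType K) (x : X)
    (F : set (borel Omega) -> dual X) : set (borel Omega) -> K^o :=
  fun A => F A x.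

Variable Omega_compact : compact [set: Omega].

(* F is the measure identified with phi. Elementary tensors span a dense subspace
   of C(Omega, X), so this determines phi from F. *)
Definition represents (X : normedModType K) (F : set (borel Omega) -> dual X)
    (phi : dual (cspace Omega_compact X)) :=
  regular_bv_measure F /\
  forall (x : X) (f : cspace Omega_compact K^o),
    phi (tensor x f) = int_against (tensor_measure x F) f.

End borel.

(* Main.v *)
Require Import Defs.
From HB Require Import structures.
From mathcomp Require Import all_boot all_order all_algebra.
From mathcomp Require Import all_classical all_reals all_analysis.
From mathcomp Require Import measurable_realfun.
Set Implicit Arguments.
Unset Strict Implicit.
Unset Printing Implicit Defensive.
Import Order.TTheory GRing.Theory Num.Theory.
Import numFieldNormedType.Exports.
Local Open Scope classical_set_scope.
Local Open Scope ring_scope.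

(** Both sides of the identity are continuous linear functionals of f, so it is
    enough to compare them on a dense set of functions.

    By [bochner_int_eval], evaluating F = h d|F| at a vector x gives
    F E x = \int_E h(w)(x) d|F|(w): the simple integrals of an L1 approximation
    of h converge in norm to the functional x |-> \int_E h(w)(x) d|F|(w).
    This functional is written down beforehand, so its norm distance to the
    simple integrals can be estimated directly. Hence the scalar measure of
    values F E x has density h x with respect to |F|, and integrating against it
    the uniform simple approximations of a scalar continuous function u yields
    the identity for the elementary tensor of x and u ([functional_tensor]).

    Sums of elementary tensors are dense ([tensor_span_dense]): if the balls of
    radius e around f(v_1), ..., f(v_n) cover f(Omega), the functions
    max(0, e - |f - f(v_i)|), divided by their sum, form a partition of unity
    built from f itself. The right-hand side is bounded on C(Omega, X) because
    |h(w)(g(w))| <= |h(w)| sup|g| and |h| is integrable; this gives the identity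
    for every f ([functional_integral]).

    Two facts make |F| and h usable in Lebesgue integrals. The variation of a
    vector measure of bounded variation is a finite measure
    ([measure_variation_finite_measure]). And h, which is a limit of simple
    functions only almost everywhere, agrees off a measurable null set N with a
    function h' that is such a limit everywhere ([bochner_integrable_modification]);
    integrals do not see N even when the integrands are not measurable
    ([eq_integral_off_null]), so h' may replace h throughout. *)

(** * Convergence in terms of the real-valued norm *)

Section rnorm_convergence.
Variables (R : realType) (b : base_field).
Local Notation K := (field_of R b).
Variable V : normedModType K.

Lemma rnormN (x : V) : rnorm (- x) = rnorm x.
Proof. by rewrite /rnorm normrN. Qed.

Lemma rnorm_distC (x y : V) : rnorm (x - y) = rnorm (y - x).
Proof. by rewrite -rnormN opprB. Qed.

Lemma ler_rnorm_dist (x y : V) : `|rnorm x - rnorm y| <= rnorm (x - y).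
Proof.
rewrite ler_norml lerNl opprB !lerBlDr; apply/andP; split.
  by rewrite rnorm_distC -{1}(subrK x y) ler_rnormD.
by rewrite -{1}(subrK y x) ler_rnormD.
Qed.

Lemma ler_rnorm_sum (I : Type) (r : seq I) (P : pred I) (u : I -> V) :
  rnorm (\sum_(i <- r | P i) u i) <= \sum_(i <- r | P i) rnorm (u i).
Proof.
elim/big_ind2 : _ => [|x1 x2 y1 y2 h1 h2|//]; first by rewrite rnorm0.
by rewrite (le_trans (ler_rnormD _ _))// lerD.
Qed.

(** Moves the epsilon of a limit from the scalar field, possibly complex, to the
    reals. *)
Lemma cvg_rnormP {T : Type} {G : set_system T} {FG : Filter G} (u : T -> V) x :
  u @ G --> x <-> forall e : R, 0 < e -> \forall t \near G, rnorm (x - u t) < e.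
Proof.
split=> [/cvgrPdist_lt ux e e0|ux].
  have e0' : 0 < ofR b e by rewrite -(ofR0 R b) ltr_ofR.
  by apply: filterS (ux _ e0') => t; rewrite rnormE ltr_ofR.
apply/cvgrPdist_lt => e e0.
have eK : e = ofR b (reK e) by rewrite -[in LHS](gtr0_norm e0) normK_ofR gtr0_norm.
rewrite eK; apply: filterS (ux (reK e) _) => [t|].
  by rewrite rnormE ltr_ofR.
by rewrite -(ltr_ofR b) -eK ofR0.
Qed.

Lemma cvg_rnorm {T : Type} {G : set_system T} {FG : Filter G} (u : T -> V) x :
  u @ G --> x -> rnorm (u t) @[t --> G] --> rnorm x.
Proof.
move=> /cvg_rnormP ux; apply/cvgrPdist_lt => e /ux.
by apply: filterS => t; apply: le_lt_trans; exact: ler_rnorm_dist.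
Qed.

Lemma cvg_rnorm_le {T : Type} {G : set_system T} {FG : Filter G}
    (u : T -> V) (v : T -> R) x :
  (\forall t \near G, rnorm (x - u t) <= v t) -> v @ G --> 0 -> u @ G --> x.
Proof.
move=> uv /cvgrPdist_lt v0; apply/cvg_rnormP => e /v0; apply: filterS2 uv => t ut.
by rewrite sub0r normrN; apply: le_lt_trans; exact: le_trans ut (ler_norm _).
Qed.

End rnorm_convergence.

(** * The variation of a vector measure *)

Section variation.
Context (R : realType) (b : base_field) d (T : measurableType d).
Variables (V : normedModType (field_of R b)) (F : set T -> V).

Lemma measure_variation_ge0 A : (0 <= measure_variation F A)%E.
Proof.
apply: ereal_sup_ubound; exists 0%N, (fun=> set0).
by split => //; [case|case|rewrite big_ord0].
Qed.

Lemma le_measure_variation A B : A `<=` B ->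
  (measure_variation F A <= measure_variation F B)%E.
Proof.
move=> AB; apply: le_ereal_sup => _ [n [P [mP PA tP ->]]].
by exists n, P; split => // i; exact: subset_trans (PA i) AB.
Qed.

(** Two families of disjoint sets, inside A and inside B, concatenate to one
    family inside the union. *)
Lemma measure_variationUD A B : A `&` B = set0 ->
  (measure_variation F A + measure_variation F B <=
   measure_variation F (A `|` B))%E.
Proof.
move=> AB0; have [AB|] := eqVneq (measure_variation F (A `|` B)) +oo%E.
  by rewrite AB leey.
rewrite -ltey => ABoo.
have Boo : measure_variation F B \is a fin_num.
  rewrite ge0_fin_numE ?measure_variation_ge0//; apply: le_lt_trans ABoo.
  by apply: le_measure_variation; exact: subsetUr.
rewrite -leeBrDr//; apply: ge_ereal_sup => _ [n [P [mP PA tP ->]]].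
rewrite leeBrDr// -leeBrDl//; apply: ge_ereal_sup => _ [m [Q [mQ QB tQ ->]]].
rewrite leeBrDl// -EFinD; apply: ereal_sup_ubound.
pose PQ (i : 'I_(n + m)) :=
  match fintype.split i with inl j => P j | inr k => Q k end.
have PQl j : PQ (lshift m j) = P j.
  by rewrite /PQ -[lshift m j]/(unsplit (inl j)) unsplitK.
have PQr j : PQ (rshift n j) = Q j.
  by rewrite /PQ -[rshift n j]/(unsplit (inr j)) unsplitK.
have disj j k : P j `&` Q k = set0.
  by apply/seteqP; split => // x [/PA Ax /QB Bx]; rewrite -AB0.
exists (n + m)%N, PQ; split.
- by move=> i; rewrite /PQ; case: fintype.split.
- move=> i; rewrite /PQ; case: fintype.split => j.
    by apply: subset_trans (PA j) _; exact: subsetUl.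
  by apply: subset_trans (QB j) _; exact: subsetUr.
- move=> i j _ _; rewrite -(splitK i) -(splitK j).
  case: (fintype.split i) (fintype.split j) => [i'|i'] [j'|j'] /=;
    rewrite ?PQl ?PQr.
  + by move/tP => ->.
  + by rewrite disj => -[].
  + by rewrite setIC disj => -[].
  + by move/tQ => ->.
- congr EFin; rewrite big_split_ord/=.
  by congr (_ + _); apply: eq_bigr => i _; rewrite ?PQl ?PQr.
Qed.

Lemma sum_measure_variation_le (A : nat -> set T) n : trivIset setT A ->
  (\sum_(0 <= i < n) measure_variation F (A i) <=
   measure_variation F (\bigcup_(i < n) A i))%E.
Proof.
move=> tA; elim: n => [|n IH].
  by rewrite big_geq// measure_variation_ge0.
rewrite big_nat_recr//= bigcup_mkord big_ord_recr/= -bigcup_mkord.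
apply: le_trans (measure_variationUD _); first exact: leeD.
apply/seteqP; split => // x [[i /= ni Aix] Anx].
have := tA i n I I (ex_intro _ x (conj Aix Anx)) => e.
by rewrite e ltnn in ni.
Qed.

Hypothesis vF : vector_measure F.

(** With all sets empty, countable additivity says that n * F(set0) converges; its
    increments F(set0) therefore tend to 0. *)
Lemma vector_measure0 : F set0 = 0.
Proof.
have := vF (fun=> measurable0) (@trivIset_set0 _ _ setT).
rewrite bigcup_const// => F0.
have F1 : \sum_(0 <= i < n.+1) F set0 @[n --> \oo] --> F set0.
  by rewrite (cvg_shiftS (fun n => \sum_(0 <= i < n) F set0)).
have : (F set0 : V) @[_ --> \oo] --> F set0 - F set0.
  have -> : (fun=> F set0) = (fun n : nat =>
      \sum_(0 <= i < n.+1) F set0 - \sum_(0 <= i < n) F set0).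
    by apply/funext => n; rewrite big_nat_recr//= addrAC subrr add0r.
  exact: cvgB.
rewrite subrr => /(cvg_unique _ (cvg_cst _)); apply; exact: norm_hausdorff.
Qed.

Lemma measure_variation0 : measure_variation F set0 = 0%E.
Proof.
apply/eqP; rewrite eq_le measure_variation_ge0 andbT.
apply: ge_ereal_sup => _ [n [P [mP P0 tP ->]]].
rewrite big1// => i _; rewrite (_ : P i = set0) ?vector_measure0 ?rnorm0//.
by rewrite -subset0; exact: P0.
Qed.

(** If the P_j are disjoint in the union of the A_i, then F(P_j) is the limit of
    the sums over i < N of F(P_j \cap A_i), and for each i the sets P_j \cap A_i
    form an admissible family for the variation of A_i. *)
Lemma measure_variation_bigcup_le (A : nat -> set T) :
  (forall n, measurable (A n)) -> trivIset setT A ->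
  (measure_variation F (\bigcup_n A n) <=
   \sum_(0 <= i <oo) measure_variation F (A i))%E.
Proof.
move=> mA tA; have vA0 n : (0 <= measure_variation F (A n))%E.
  exact: measure_variation_ge0.
apply: ge_ereal_sup => _ [n [P [mP PA tP ->]]].
have FP j : rnorm (\sum_(0 <= i < N) F (P j `&` A i)) @[N --> \oo] -->
    rnorm (F (P j)).
  apply: cvg_rnorm.
  rewrite -[X in F X](setIidl (PA j)) setI_bigcupr; apply: vF.
    by move=> i; exact: measurableI.
  exact: trivIset_setIl.
have cF : \sum_(j < n) rnorm (\sum_(0 <= i < N) F (P j `&` A i)) @[N --> \oo]
    --> \sum_(j < n) rnorm (F (P j)).
  by apply: cvg_big => [|j _]; [exact: add_continuous|exact: FP].
have le_series N : ((\sum_(j < n) rnorm (\sum_(0 <= i < N) F (P j `&` A i)))%:E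
    <= \sum_(0 <= i <oo) measure_variation F (A i))%E.
  apply: le_trans (nneseries_lim_ge N _) => //.
  apply: (@le_trans _ _
      (\sum_(0 <= i < N) (\sum_(j < n) rnorm (F (P j `&` A i)))%:E)%E).
    rewrite sumEFin lee_fin exchange_big/=; apply: ler_sum => j _.
    exact: ler_rnorm_sum.
  apply: lee_sum => i _; apply: ereal_sup_ubound.
  exists n, (fun j => P j `&` A i); split => //.
  - by move=> j; exact: measurableI.
  - exact: trivIset_setIr.
have [->|] := eqVneq (\sum_(0 <= i <oo) measure_variation F (A i))%E +oo%E.
  by rewrite leey.
rewrite -ltey => Aoo.
have /fineK sE : (\sum_(0 <= i <oo) measure_variation F (A i))%E \is a fin_num.
  by rewrite ge0_fin_numE// nneseries_ge0.
rewrite -sE lee_fin -(cvg_lim (@Rhausdorff _) cF); apply: limr_le.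
  by apply/cvg_ex; eexists; exact: cF.
by apply: nearW => N /=; rewrite -lee_fin sE.
Qed.

Lemma measure_variation_semi_sigma_additive :
  semi_sigma_additive (measure_variation F).
Proof.
move=> A mA tA mUA; have vA0 n : (0 <= measure_variation F (A n))%E.
  exact: measure_variation_ge0.
suff -> : measure_variation F (\bigcup_n A n) =
    (\sum_(0 <= i <oo) measure_variation F (A i))%E.
  by apply: is_cvg_nneseries => n _ _.
apply/eqP; rewrite eq_le measure_variation_bigcup_le//=.
apply: lime_le; first by apply: is_cvg_nneseries => n _ _.
apply: nearW => n; apply: le_trans (sum_measure_variation_le _ tA) _.
by apply: le_measure_variation => x [i /= _ Aix]; exists i.
Qed.

Hypothesis Foo : (measure_variation F setT < +oo)%E.

Lemma measure_variation_fin_num : fin_num_fun (measure_variation F).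
Proof.
move=> A _; rewrite ge0_fin_numE ?measure_variation_ge0//.
by apply: le_lt_trans Foo; exact: le_measure_variation.
Qed.

(** Stated as an equality of set functions, which lets the measure structure be
    introduced by rewriting. *)
Lemma measure_variation_finite_measure :
  exists mu : {finite_measure set T -> \bar R}, measure_variation F = mu.
Proof.
pose mix1 := isMeasure.Build d T R (measure_variation F) measure_variation0
  measure_variation_ge0 measure_variation_semi_sigma_additive.
pose mu1 : {measure set T -> \bar R} := HB.pack (measure_variation F) mix1.
pose mix2 := Measure_isFinite.Build d T R mu1 measure_variation_fin_num.
pose mu2 : {finite_measure set T -> \bar R} := HB.pack (measure_variation F) mu1 mix2.
by exists mu2.
Qed.

End variation.

(** * Real and imaginary parts *)

Section scalars.
Variables (R : realType) (b : base_field).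
Local Notation K := (field_of R b).
Implicit Types x y : K.

Lemma reKD x y : reK (x + y) = reK x + reK y.
Proof. by rewrite /reK; move: x y; case: b => //= -[x x'] [y y']. Qed.

Lemma imKD x y : imK (x + y) = imK x + imK y.
Proof. by rewrite /imK; move: x y; case: b => /= [|[x x'] [y y']//]; rewrite addr0. Qed.

Lemma reKM x y : reK (x * y) = reK x * reK y - imK x * imK y.
Proof.
rewrite /reK /imK; move: x y; case: b => /= [x y|[x x'] [y y']//].
by rewrite mulr0 subr0.
Qed.

Lemma imKM x y : imK (x * y) = reK x * imK y + imK x * reK y.
Proof.
rewrite /reK /imK; move: x y; case: b => /= [x y|[x x'] [y y']//].
by rewrite mulr0 mul0r addr0.
Qed.

Lemma reK0 : reK (0 : K) = 0. Proof. by rewrite /reK; case: b. Qed.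
Lemma imK0 : imK (0 : K) = 0. Proof. by rewrite /imK; case: b. Qed.

Lemma reK_ofR (r : R) : reK (ofR b r) = r. Proof. exact: ofRK. Qed.
Lemma imK_ofR (r : R) : imK (ofR b r) = 0. Proof. by rewrite /imK; case: b. Qed.

Lemma eqK x y : reK x = reK y -> imK x = imK y -> x = y.
Proof.
by rewrite /reK /imK; move: x y; case: b => //= -[x x'] [y y'] /= -> ->.
Qed.

Let rnormKE (x : K) : rnorm (x : K^o) = reK `|x|. Proof. by []. Qed.

Lemma reK_le (x : K^o) : `|reK x| <= rnorm x.
Proof.
rewrite rnormKE /reK; move: x; case: b => /= [x|z]; first by rewrite lexx.
case: z => x x' /=; rewrite -sqrtr_sqr ler_sqrt ?lerDl ?sqr_ge0//.
by rewrite addr_ge0 ?sqr_ge0.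
Qed.

Lemma imK_le (x : K^o) : `|imK x| <= rnorm x.
Proof.
rewrite rnormKE /reK /imK; move: x; case: b => /= [x|z]; first by rewrite normr0.
case: z => x x' /=; rewrite -sqrtr_sqr ler_sqrt ?lerDr ?sqr_ge0//.
by rewrite addr_ge0 ?sqr_ge0.
Qed.

Lemma rnorm_le_reim (x : K^o) : rnorm x <= `|reK x| + `|imK x|.
Proof.
rewrite rnormKE /reK /imK; move: x; case: b => /= [x|z]; first by rewrite normr0 addr0.
case: z => x x' /=; rewrite -[leRHS]ger0_norm ?addr_ge0// -sqrtr_sqr ler_sqrt ?sqr_ge0//.
by rewrite sqrrD !real_normK ?num_real// lerD2r lerDl mulrn_wge0 ?mulr_ge0.
Qed.

Lemma rnormM (x y : K^o) : rnorm (x * y : K^o) = rnorm x * rnorm y.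
Proof. exact: (rnormZ x y). Qed.

Lemma rnorm_ofR (r : R) : rnorm (ofR b r : K^o) = `|r|.
Proof.
apply/eqP; rewrite eq_le; apply/andP; split.
  by rewrite (le_trans (rnorm_le_reim _))// reK_ofR imK_ofR normr0 addr0.
by apply: le_trans (reK_le _); rewrite reK_ofR.
Qed.

End scalars.

(** * Simple functions and their pointwise limits *)

Section simple_functions.
Context (R : realType) (b : base_field) d (T : measurableType d).
Local Notation K := (field_of R b).

Lemma simple_fun_preimage (V : normedModType K) (s : T -> V) B :
  simple_fun s -> measurable (s @^-1` B).
Proof.
move=> [fs ms]; rewrite (_ : _ @^-1` _ =
    \bigcup_(v in range s `&` B) s @^-1` [set v]).
  by apply: fin_bigcup_measurable => //; exact: finite_setIl.
apply/seteqP; split => [x Bsx|x [v [_ Bv] sxv]]; first by exists (s x).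
by rewrite /preimage/= sxv.
Qed.

Lemma simple_fun_cst (V : normedModType K) (v : V) : simple_fun (fun _ : T => v).
Proof.
split=> [|u]; first by apply: sub_finite_set (finite_set1 v) => _ [x _ <-].
have [->|vu] := eqVneq v u.
  by rewrite (_ : _ @^-1` _ = setT)//; apply/seteqP.
rewrite (_ : _ @^-1` _ = set0)//; apply/seteqP; split => // x /= vu'.
by rewrite vu' eqxx in vu.
Qed.

(** The level sets of op(s, t) split along the finitely many values of s, and
    preimages of arbitrary sets under t are measurable. *)
Lemma simple_fun_op (U V W : normedModType K) (op : U -> V -> W) s t :
  simple_fun s -> simple_fun t -> simple_fun (fun x : T => op (s x) (t x)).
Proof.
move=> ss st; split.
  apply: (@sub_finite_set _ _ [set op u v | u in range s & v in range t]).
    by move=> _ [x _ <-]; exists (s x) => //; exists (t x).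
  by apply: finite_image2; [case: ss|case: st].
move=> w; rewrite (_ : _ @^-1` _ = \bigcup_(u in range s)
    (s @^-1` [set u] `&` t @^-1` [set v | op u v = w])).
  apply: fin_bigcup_measurable; first by case: ss.
  by move=> u _; apply: measurableI; exact: simple_fun_preimage.
apply/seteqP; split => [x /= <-|x [u _ /= [-> //]]].
by exists (s x).
Qed.

Lemma simple_fun_patch (V : normedModType K) (s : T -> V) A :
  measurable A -> simple_fun s -> simple_fun (fun x => if x \in A then s x else 0).
Proof.
move=> mA ss; split.
  apply: (@sub_finite_set _ _ (range s `|` [set 0])).
    move=> _ [x _ <-]; case: ifP => _; last by right.
    by left; exists x.
  by rewrite finite_setU; split => //; case: ss.
move=> v; have [->|v0] := eqVneq v 0.
  rewrite (_ : _ @^-1` _ = (~` A) `|` s @^-1` [set 0]).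
    apply: measurableU; first exact: measurableC.
    exact: simple_fun_preimage.
  apply/seteqP; split => x; rewrite /preimage /=.
    by have [/set_mem Ax|/negP nAx _] := boolP (x \in A);
      [right|left; apply: contra_not nAx; exact: mem_set].
  by have [/set_mem Ax [//|]|//] := boolP (x \in A).
rewrite (_ : _ @^-1` _ = A `&` s @^-1` [set v]).
  by apply: measurableI => //; exact: simple_fun_preimage.
apply/seteqP; split => [x /=|x [/= Ax]].
  by case: ifPn => [|_ v0']; [rewrite inE|rewrite v0' eqxx in v0].
by rewrite mem_set.
Qed.

Lemma simple_fun_bounded (V : normedModType K) (s : T -> V) : simple_fun s ->
  exists M, forall x, rnorm (s x) <= M.
Proof.
move=> [/finite_seqP[r rE] _]; exists (\sum_(v <- r) rnorm v) => x.
have sr : s x \in r by have : range s (s x) by []; rewrite rE.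
rewrite (big_rem _ sr)/= lerDl sumr_ge0// => v _; exact: rnorm_ge0.
Qed.

(** Strong measurability with convergence at every point: unlike convergence
    almost everywhere, it makes the norm and the coordinates measurable. *)
Definition limit_simple (V : normedModType K) (g : T -> V) :=
  exists2 u : nat -> T -> V, forall n, simple_fun (u n) &
    forall x, u n x @[n --> \oo] --> g x.

Lemma simple_limit_simple (V : normedModType K) (s : T -> V) :
  simple_fun s -> limit_simple s.
Proof. by move=> ss; exists (fun=> s) => // x; exact: cvg_cst. Qed.

Lemma limit_simple_op (U V W : normedModType K) (op : U -> V -> W) g h :
  (forall (u : nat -> U) (v : nat -> V) x y, u @ \oo --> x -> v @ \oo --> y ->
    op (u n) (v n) @[n --> \oo] --> op x y) ->
  limit_simple g -> limit_simple h ->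
  limit_simple (fun x => op (g x) (h x)).
Proof.
move=> cop [u su ug] [v sv vh]; exists (fun n x => op (u n x) (v n x)).
  by move=> n; exact: simple_fun_op.
by move=> x; exact: cop.
Qed.

Lemma limit_simple_measurable (V : normedModType K) (g : T -> V) (p : V -> R) :
  (forall (u : nat -> V) x, u @ \oo --> x -> p (u n) @[n --> \oo] --> p x) ->
  limit_simple g -> measurable_fun setT (p \o g).
Proof.
move=> cp [u su ug]; apply: (@measurable_fun_cvg _ _ _ _ (fun n => p \o u n)).
  move=> n _ B mB; rewrite setTI comp_preimage.
  exact: simple_fun_preimage.
by move=> x _; exact: cp.
Qed.

Lemma limit_simple_rnorm (V : normedModType K) (g : T -> V) :
  limit_simple g -> measurable_fun setT (fun x => rnorm (g x)).
Proof. by apply: limit_simple_measurable => u x; exact: cvg_rnorm. Qed.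

Lemma limit_simpleB (V : normedModType K) (g h : T -> V) :
  limit_simple g -> limit_simple h -> limit_simple (fun x => g x - h x).
Proof.
by apply: (limit_simple_op (op := fun u v : V => u - v)) => *; exact: cvgB.
Qed.

End simple_functions.

(** * Integrals and null sets *)

Section null_sets.
Import HBNNSimple.
Context d (T : measurableType d) (R : realType).
Variables (mu : {measure set T -> \bar R}) (N : set T).
Hypotheses (mN : measurable N) (N0 : mu N = 0%E).

(** The integral of a nonnegative f is a supremum over the simple functions below
    f; set to 0 on N, such a function is also below g and keeps its integral. *)
Lemma eq_integral_off_null D (f g : T -> \bar R) :
  (forall x, ~ N x -> f x = g x) ->
  (\int[mu]_(x in D) f x = \int[mu]_(x in D) g x)%E.
Proof.
have le0 (f' g' : T -> \bar R) : (forall x, 0 <= f' x)%E ->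
    (forall x, 0 <= g' x)%E -> (forall x, ~ N x -> f' x = g' x) ->
    (\int[mu]_x f' x <= \int[mu]_x g' x)%E.
  move=> f0 g0 fg; rewrite ge0_integralTE// (ge0_integralTE _ g0).
  apply: ge_ereal_sup => _ [s /= sf <-].
  have mNC : measurable (~` N) by exact: measurableC.
  apply: ereal_sup_ubound; exists (proj_nnsfun s mNC) => /=.
    move=> x; have := mrestrict s mNC => /(congr1 (fun u => u x)) /= <-.
    rewrite patchE; case: ifPn => // /set_mem Nx.
    by rewrite -fg.
  have sE (u : {nnsfun T >-> R}) : sintegral mu u = (\int[mu]_x (u x)%:E)%E.
    by rewrite integral_nnsfun// patch_setT.
  rewrite !sE.
  apply: ae_eq_integral => //; [exact/measurable_EFinP|exact/measurable_EFinP|].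
  exists N; split => // x /=; apply: contra_notP => Nx _.
  have := mrestrict s mNC => /(congr1 (fun u => u x)) /= <-.
  by rewrite patchE mem_set.
have eq0 (f' g' : T -> \bar R) : (forall x, 0 <= f' x)%E ->
    (forall x, 0 <= g' x)%E -> (forall x, ~ N x -> f' x = g' x) ->
    (\int[mu]_(x in D) f' x = \int[mu]_(x in D) g' x)%E.
  move=> f0 g0 fg; rewrite integral_mkcond [RHS]integral_mkcond.
  by apply/eqP; rewrite eq_le !le0// => x; try exact: erestrict_ge0;
    move=> Nx; rewrite !patchE; case: ifP => // _; rewrite fg.
move=> fg; rewrite integralE [RHS]integralE.
by congr (_ - _)%E; apply: eq0 => // x Nx; rewrite ?funeposE ?funenegE fg.
Qed.

End null_sets.

(** * Integration of scalar functions *)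

Section scalar_integration.
Context (R : realType) (b : base_field) d (T : measurableType d).
Local Notation K := (field_of R b).
Variable mu : {finite_measure set T -> \bar R}.

Lemma integrableZ_EFin D (r : R) (f : T -> R) : measurable D ->
  mu.-integrable D (EFin \o f) ->
  mu.-integrable D (EFin \o (fun x => r * f x)).
Proof. by move=> mD jf; exact: eq_integrable (integrableZl mD r jf). Qed.

(** Bochner integrability in the form used below: by dominated convergence it is
    equivalent to the existence of an L1 approximation. *)
Definition norm_integrable (V : normedModType K) (g : T -> V) :=
  limit_simple g /\ mu.-integrable setT (fun x => (rnorm (g x))%:E).

Definition norm_integral (V : normedModType K) (g : T -> V) : R :=
  (\int[mu]_x rnorm (g x))%R.

Lemma norm_integral_ge0 (V : normedModType K) (g : T -> V) : 0 <= norm_integral g.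
Proof. by apply: Rintegral_ge0 => x _; exact: rnorm_ge0. Qed.

Lemma norm_integrable_le (V : normedModType K) (g : T -> V) (k : T -> R) :
  limit_simple g -> mu.-integrable setT (EFin \o k) ->
  (forall x, rnorm (g x) <= k x) -> norm_integrable g.
Proof.
move=> lg ik gk; split => //; apply: le_integrable ik => //.
  by apply/measurable_EFinP; exact: limit_simple_rnorm.
move=> x _ /=; rewrite lee_fin ger0_norm ?rnorm_ge0//.
exact: le_trans (gk x) (ler_norm _).
Qed.

Lemma norm_integrable_bounded (V : normedModType K) (g : T -> V) (M : R) :
  limit_simple g -> (forall x, rnorm (g x) <= M) -> norm_integrable g.
Proof.
move=> lg gM; apply: (@norm_integrable_le _ _ (cst M)) => //.
exact: finite_measure_integrable_cst.
Qed.

Lemma simple_norm_integrable (V : normedModType K) (s : T -> V) :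
  simple_fun s -> norm_integrable s.
Proof.
move=> ss; have [M sM] := simple_fun_bounded ss.
by apply: norm_integrable_bounded sM; exact: simple_limit_simple.
Qed.

Lemma norm_integrableB (V : normedModType K) (g h : T -> V) :
  norm_integrable g -> norm_integrable h ->
  norm_integrable (fun x => g x - h x).
Proof.
move=> [lg ig] [lh ih].
apply: (@norm_integrable_le _ _ (fun x => rnorm (g x) + rnorm (h x))).
- exact: limit_simpleB.
- by apply: eq_integrable (integrableD measurableT ig ih) => // x _.
- by move=> x; rewrite -[rnorm (h x)]rnormN; exact: ler_rnormD.
Qed.

Lemma norm_integral_leD (U V W : normedModType K) (g : T -> U) (h : T -> V)
    (k : T -> W) (c c' : R) :
  norm_integrable g -> norm_integrable h -> norm_integrable k ->
  (forall x, rnorm (g x) <= c * rnorm (h x) + c' * rnorm (k x)) ->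
  norm_integral g <= c * norm_integral h + c' * norm_integral k.
Proof.
move=> [_ ig] [_ ih] [_ ik] ghk.
have ich := integrableZ_EFin c measurableT ih.
have ick := integrableZ_EFin c' measurableT ik.
rewrite -!RintegralZl// -RintegralD//; apply: le_Rintegral => //.
by apply: eq_integrable (integrableD measurableT ich ick) => // x _.
Qed.

Lemma norm_integral_le (V W : normedModType K) (g : T -> V) (h : T -> W) (c : R) :
  norm_integrable g -> norm_integrable h ->
  (forall x, rnorm (g x) <= c * rnorm (h x)) ->
  norm_integral g <= c * norm_integral h.
Proof.
move=> ig ih gh; have := @norm_integral_leD _ _ _ g h h c 0 ig ih ih.
by rewrite mul0r addr0; apply => x; rewrite mul0r addr0.
Qed.

Definition scalar_integrable (D : set T) (g : T -> K^o) :=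
  mu.-integrable D (EFin \o (@reK R b \o g)) /\
  mu.-integrable D (EFin \o (@imK R b \o g)).

(** Real and imaginary parts are 1-Lipschitz for the norm, hence measurable along
    limits of simple functions and dominated by the norm. *)
Lemma norm_integrable_scalar D (g : T -> K^o) : measurable D ->
  norm_integrable g -> scalar_integrable D g.
Proof.
move=> mD [lg ig].
have reKN (x : K) : reK (- x) = - reK x.
  by apply/eqP; rewrite -addr_eq0 -reKD addNr reK0.
have imKN (x : K) : imK (- x) = - imK x.
  by apply/eqP; rewrite -addr_eq0 -imKD addNr imK0.
split; apply: (integrableS measurableT) => //; apply: le_integrable ig => //.
- apply/measurable_EFinP; apply: limit_simple_measurable lg => u x.
  move=> /cvg_rnormP ux; apply/cvgrPdist_lt => e /ux; apply: filterS => n.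
  by apply: le_lt_trans; rewrite -reKN -reKD; exact: reK_le.
- by move=> x _; rewrite lee_fin [leRHS]ger0_norm ?rnorm_ge0//; exact: reK_le.
- apply/measurable_EFinP; apply: limit_simple_measurable lg => u x.
  move=> /cvg_rnormP ux; apply/cvgrPdist_lt => e /ux; apply: filterS => n.
  by apply: le_lt_trans; rewrite -imKN -imKD; exact: imK_le.
- by move=> x _; rewrite lee_fin [leRHS]ger0_norm ?rnorm_ge0//; exact: imK_le.
Qed.

Lemma reK_scalar_int D (g : T -> K^o) :
  reK (scalar_int mu D g) = (\int[mu]_(x in D) reK (g x))%R.
Proof. by rewrite /scalar_int /mkK /reK /Rintegral; case: b g. Qed.

Lemma imK_scalar_int D (g : T -> K^o) :
  imK (scalar_int mu D g) = (\int[mu]_(x in D) imK (g x))%R.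
Proof.
rewrite /scalar_int /mkK /imK /Rintegral; case: b g => //= _.
by rewrite integral0.
Qed.

Lemma eq_scalar_int D (f g : T -> K^o) : {in D, f =1 g} ->
  scalar_int mu D f = scalar_int mu D g.
Proof.
by move=> fg; apply: eqK; rewrite ?reK_scalar_int ?imK_scalar_int;
  apply: eq_Rintegral => x /fg ->.
Qed.

Lemma scalar_integrableD D f g : measurable D ->
  scalar_integrable D f -> scalar_integrable D g ->
  scalar_integrable D (fun x => f x + g x).
Proof.
move=> mD [rf jf] [rg jg]; split.
- apply: eq_integrable (integrableD mD rf rg) => // x _ /=.
  by rewrite reKD.
- apply: eq_integrable (integrableD mD jf jg) => // x _ /=.
  by rewrite imKD.
Qed.

Lemma scalar_intD D f g : measurable D ->
  scalar_integrable D f -> scalar_integrable D g ->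
  scalar_int mu D (fun x => f x + g x) = scalar_int mu D f + scalar_int mu D g.
Proof.
move=> mD [rf jf] [rg jg]; apply: eqK.
- rewrite reKD !reK_scalar_int -RintegralD//.
  by apply: eq_Rintegral => x _; rewrite reKD.
- rewrite imKD !imK_scalar_int -RintegralD//.
  by apply: eq_Rintegral => x _; rewrite imKD.
Qed.

Lemma scalar_integrableZ D (c : K) g : measurable D ->
  scalar_integrable D g -> scalar_integrable D (fun x => c * g x).
Proof.
move=> mD [rg jg]; split.
- apply: eq_integrable (integrableB mD (integrableZl mD (reK c) rg)
    (integrableZl mD (imK c) jg)) => // x _ /=.
  by rewrite reKM.
- apply: eq_integrable (integrableD mD (integrableZl mD (reK c) jg)
    (integrableZl mD (imK c) rg)) => // x _ /=.
  by rewrite imKM.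
Qed.

Lemma scalar_intZ D (c : K) g : measurable D -> scalar_integrable D g ->
  scalar_int mu D (fun x => c * g x) = c * scalar_int mu D g.
Proof.
move=> mD [rg jg]; apply: eqK.
- rewrite reKM !reK_scalar_int !imK_scalar_int -!RintegralZl// -RintegralB//;
    try exact: integrableZ_EFin.
  by apply: eq_Rintegral => x _; rewrite reKM.
- rewrite imKM !reK_scalar_int !imK_scalar_int -!RintegralZl// -RintegralD//;
    try exact: integrableZ_EFin.
  by apply: eq_Rintegral => x _; rewrite imKM.
Qed.

Lemma scalar_integrable0 D : measurable D -> scalar_integrable D (fun=> 0).
Proof.
by move=> mD; split; apply: eq_integrable (integrable0 mu D) => // x _ /=;
  rewrite ?reK0 ?imK0.
Qed.

Lemma scalar_int0 D : scalar_int mu D (fun=> 0 : K^o) = 0.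
Proof.
by apply: eqK; rewrite ?reK_scalar_int ?imK_scalar_int ?reK0 ?imK0;
  rewrite /Rintegral integral0.
Qed.

Lemma scalar_integrable_sum D (I : Type) (r : seq I) (f : I -> T -> K^o) :
  measurable D -> (forall i, scalar_integrable D (f i)) ->
  scalar_integrable D (fun x => \sum_(i <- r) f i x).
Proof.
move=> mD jf; elim: r => [|i r IH].
  rewrite (_ : (fun _ => _) = (fun=> 0)); first exact: scalar_integrable0.
  by apply/funext => x; rewrite big_nil.
rewrite (_ : (fun _ => _) = (fun x => f i x + \sum_(j <- r) f j x)).
  exact: scalar_integrableD.
by apply/funext => x; rewrite big_cons.
Qed.

Lemma scalar_int_sum D (I : Type) (r : seq I) (f : I -> T -> K^o) :
  measurable D -> (forall i, scalar_integrable D (f i)) ->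
  scalar_int mu D (fun x => \sum_(i <- r) f i x) =
  \sum_(i <- r) scalar_int mu D (f i).
Proof.
move=> mD jf; elim: r => [|i r IH].
  rewrite big_nil -[RHS](scalar_int0 D).
  by apply: eq_scalar_int => x _; rewrite big_nil.
rewrite big_cons -IH -scalar_intD//; last exact: scalar_integrable_sum.
by apply: eq_scalar_int => x _; rewrite big_cons.
Qed.

(** Restriction to A with the value 0 of the field elsewhere, so that its real and
    imaginary parts are restrictions too. *)
Definition zero_outside (A : set T) (g : T -> K^o) : T -> K^o :=
  fun x => if x \in A then g x else 0.

Lemma scalar_integrable_zero_outside D A g : measurable D -> measurable A ->
  scalar_integrable D g -> scalar_integrable D (zero_outside A g).
Proof.
move=> mD mA [rg jg].
have mDA : measurable (D `&` A) by exact: measurableI.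
have cutE (p : K -> R) : p 0 = 0 -> mu.-integrable D (EFin \o (p \o g)) ->
    mu.-integrable D (EFin \o (p \o zero_outside A g)).
  move=> p0 jp; rewrite integrable_mkcond//.
  have : mu.-integrable (D `&` A) (EFin \o (p \o g)).
    by apply: integrableS jp; [..|exact: subIsetl].
  move=> /(integrable_mkcond _ mDA); apply: eq_integrable => // x _.
  rewrite !patchE in_setI /= /zero_outside.
  by case: (x \in D); case: (x \in A) => //=; rewrite p0.
by split; apply: cutE; rewrite ?reK0 ?imK0.
Qed.

Lemma scalar_int_zero_outside D A g :
  scalar_int mu D (zero_outside A g) = scalar_int mu (D `&` A) g.
Proof.
have cutE (p : K -> R) : p 0 = 0 ->
    (\int[mu]_(x in D) p (zero_outside A g x) = \int[mu]_(x in D `&` A) p (g x))%R.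
  move=> p0; rewrite Rintegral_mkcondr; apply: eq_Rintegral => x _.
  by rewrite patchE /zero_outside; case: ifP.
by apply: eqK; rewrite ?reK_scalar_int ?imK_scalar_int;
  apply: cutE; rewrite ?reK0 ?imK0.
Qed.

(** With g = 1 this computes the integral of a simple function; with g a density
    it turns sums of values of the measure into an integral. *)
Lemma scalar_int_simple (V : normedModType K) D (s : T -> V) (p : V -> K)
    (g : T -> K^o) :
  measurable D -> simple_fun s -> scalar_integrable D g ->
  scalar_int mu D (fun x => p (s x) * g x) =
  \sum_(v \in range s) p v * scalar_int mu (D `&` s @^-1` [set v]) g.
Proof.
move=> mD ss jg; have [fs _] := ss; rewrite fsbig_finite//=.
have mv v : measurable (s @^-1` [set v]) by exact: simple_fun_preimage.
rewrite (eq_bigr (fun v => scalar_int mu D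
    (fun x => p v * zero_outside (s @^-1` [set v]) g x))); last first.
  move=> v _; rewrite -scalar_int_zero_outside scalar_intZ//.
  exact: scalar_integrable_zero_outside.
rewrite -scalar_int_sum//; last first.
  by move=> v; apply: scalar_integrableZ => //; exact: scalar_integrable_zero_outside.
apply: eq_scalar_int => x _.
have srx : s x \in finmap.enum_fset (fset_set (range s)).
  by rewrite [_ \in _]in_fset_set// inE; exists x.
rewrite (bigD1_seq (s x))//= ?finmap.fset_uniq// big1 ?addr0 /zero_outside.
  by rewrite mem_set.
by move=> v vs; rewrite ifF ?mulr0//; apply/negbTE/negP => /set_mem /= e;
  rewrite e eqxx in vs.
Qed.

Lemma scalar_int_cst1 D : measurable D ->
  scalar_int mu D (fun=> 1) = ofR b (fine (mu D)).
Proof.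
move=> mD; have re1 : reK (1 : K) = 1 by rewrite /reK; case: b.
have im1 : imK (1 : K) = 0 by rewrite /imK; case: b.
apply: eqK; rewrite ?reK_scalar_int ?imK_scalar_int Rintegral_cst//.
  by rewrite re1 mul1r reK_ofR.
by rewrite im1 mul0r imK_ofR.
Qed.

Lemma scalar_integrable_cst1 D : measurable D ->
  scalar_integrable D (fun=> 1 : K^o).
Proof.
move=> mD; apply: norm_integrable_scalar => //.
by apply: simple_norm_integrable; exact: simple_fun_cst.
Qed.

(** The factor 2 comes from bounding real and imaginary parts separately; only a
    constant independent of g matters below. *)
Lemma rnorm_scalar_int_le D (g : T -> K^o) : measurable D ->
  norm_integrable g -> rnorm (scalar_int mu D g) <= 2 * norm_integral g.
Proof.
move=> mD ig; have [rg jg] := norm_integrable_scalar mD ig.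
have [_ ng] := ig.
have ngD : mu.-integrable D (fun x => (rnorm (g x))%:E) by apply: integrableS ng.
have DT : (\int[mu]_(x in D) rnorm (g x) <= norm_integral g)%R.
  rewrite /norm_integral Rintegral_mkcond; apply: le_Rintegral => //.
    have := ngD; move=> /(integrable_mkcond _ mD); apply: eq_integrable => // x _.
    by rewrite /= !patchE; case: ifP.
  by move=> x _; rewrite patchE; case: ifP => // _; exact: rnorm_ge0.
apply: le_trans (rnorm_le_reim _) _; rewrite mulr_natl mulr2n.
rewrite reK_scalar_int imK_scalar_int; apply: lerD; apply: le_trans DT.
- apply: le_trans (le_normr_Rintegral mD rg) _; apply: le_Rintegral => //.
    exact: integrable_norm.
  by move=> x _; exact: reK_le.
- apply: le_trans (le_normr_Rintegral mD jg) _; apply: le_Rintegral => //.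
    exact: integrable_norm.
  by move=> x _; exact: imK_le.
Qed.

End scalar_integration.

(** * The dual space *)

Section dual_space.
Context (R : realType) (b : base_field).
Local Notation K := (field_of R b).
Variable X : normedModType K.

Lemma ofR1 : ofR b 1 = 1 :> K. Proof. by rewrite /ofR; case: b. Qed.

Lemma dual_rnormE (p : dual X) : rnorm p = supnorm (@closed_unit_ball R b X) p.
Proof. exact: ofRK. Qed.

(** Homogeneity reduces to the unit ball, where the supremum defining the dual
    norm applies. *)
Lemma ler_dual (p : dual X) (x : X) : rnorm (p x) <= rnorm p * rnorm x.
Proof.
have [->|x0] := eqVneq x 0; first by rewrite linear0 !rnorm0 mulr0.
have nx0 : 0 < rnorm x.
  by rewrite lt_def rnorm_ge0 andbT; apply: contra_neq x0; exact: rnorm_eq0.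
have nV : reK `|ofR b (rnorm x)^-1| = (rnorm x)^-1.
  by rewrite -[LHS]/(rnorm (ofR b (rnorm x)^-1 : K^o)) rnorm_ofR gtr0_norm ?invr_gt0.
have : rnorm (p (ofR b (rnorm x)^-1 *: x)) <= rnorm p.
  rewrite dual_rnormE; apply: ler_supnorm; first exact: dual_bounded.
  by rewrite /closed_unit_ball/= rnormE rnormZ nV mulVf ?ofR1// gt_eqF.
by rewrite linearZ rnormZ nV mulrC ler_pdivrMr.
Qed.

Lemma dual_rnorm_le (p : dual X) (M : R) : 0 <= M ->
  (forall x, rnorm (p x) <= M * rnorm x) -> rnorm p <= M.
Proof.
move=> M0 pM; rewrite dual_rnormE; apply: supnorm_le => // x.
rewrite /closed_unit_ball/= rnormE -ofR1 ler_ofR => x1.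
by apply: le_trans (pM x) _; rewrite ler_piMr.
Qed.

Lemma dual_sumE (I : Type) (r : seq I) (p : I -> dual X) (x : X) :
  (\sum_(i <- r) p i) x = \sum_(i <- r) p i x.
Proof. by elim/big_rec2 : _ => // i _ q _ <-. Qed.

Lemma bounded_linear_dual (L : X -> K^o) (M : R) :
  (forall a u v, L (a *: u + v) = a * L u + L v) ->
  (forall x, rnorm (L x) <= M * rnorm x) -> exists p : dual X, forall x, p x = L x.
Proof.
move=> Ll LM.
have LB u v : L (u - v) = L u - L v.
  by rewrite addrC -scaleN1r Ll mulN1r addrC.
have Lp : L \in @dual_pred R b X.
  apply/asboolP; split => // x; apply: (@cvg_rnorm_le _ _ _ _ _ _ _
      (fun y => M * rnorm (x - y))).
    by apply: nearW => y; rewrite -LB.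
  rewrite -[X in _ --> X](mulr0 M); apply: cvgMl_tmp.
  rewrite -[X in _ --> X](@rnorm0 R b X); apply: cvg_rnorm.
  by rewrite -[X in _ --> X](subrr x); apply: cvgB => //; exact: cvg_cst.
by exists (Dual Lp).
Qed.

Lemma cvg_dual_eval (p : nat -> dual X) (u : nat -> X) (q : dual X) (x : X) :
  p @ \oo --> q -> u @ \oo --> x -> (p n (u n) : K^o) @[n --> \oo] --> (q x : K^o).
Proof.
move=> pq ux; apply: (@cvg_rnorm_le _ _ _ _ _ _ _ (fun n =>
    rnorm (q - p n) * rnorm x + rnorm (p n) * rnorm (x - u n))).
  apply: nearW => n; have -> : q x - p n (u n) = (q - p n) x + p n (x - u n).
    by rewrite linearB/= addrA subrK.
  by apply: le_trans (ler_rnormD _ _) _; apply: lerD; exact: ler_dual.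
have dist0 (V : normedModType K) (v : nat -> V) y : v @ \oo --> y ->
    rnorm (y - v n) @[n --> \oo] --> 0.
  move=> vy; rewrite -[X in _ --> X](@rnorm0 R b V); apply: cvg_rnorm.
  by rewrite -[X in _ --> X](subrr y); apply: cvgB => //; exact: cvg_cst.
rewrite -[X in _ --> X](addr0 0) -[X in _ --> X + _](mul0r (rnorm x)).
rewrite -[X in _ --> _ + X](mulr0 (rnorm q)).
apply: cvgD; first by apply: cvgMr_tmp; exact: dist0.
by apply: cvgM; [exact: cvg_rnorm|exact: dist0].
Qed.

End dual_space.

(** * Bochner integrable functions up to null sets *)

Section modification.
Context (R : realType) (b : base_field) d (T : measurableType d).
Local Notation K := (field_of R b).
Variable mu : {finite_measure set T -> \bar R}.

(** Setting h and its approximations to 0 on the null set where convergence may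
    fail gives convergence everywhere. *)
Lemma strongly_measurable_modification (V : normedModType K) (h : T -> V) :
  strongly_measurable mu h ->
  exists N h', [/\ measurable N, mu N = 0%E, forall x, ~ N x -> h x = h' x &
    limit_simple h'].
Proof.
move=> [s [ss [N [mN N0 sN]]]].
exists N, (fun x => if x \in ~` N then h x else 0); split => //.
  by move=> x Nx; rewrite mem_set.
exists (fun n x => if x \in ~` N then s n x else 0).
  by move=> n; apply: simple_fun_patch => //; exact: measurableC.
move=> x; case: ifPn => [/set_mem Nx|_]; last exact: cvg_cst.
by apply: contrapT => sx; apply: Nx; exact: sN.
Qed.

(** Along an L1 approximation the integrals are finite only eventually, hence the
    first conclusion. *)
Lemma L1_approx_norm_integral (V : normedModType K) (h h' : T -> V) N s :
  measurable N -> mu N = 0%E -> (forall x, ~ N x -> h x = h' x) ->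
  L1_approx mu h s ->
  (\forall n \near \oo, (\int[mu]_x (rnorm (h' x - s n x))%:E)%E \is a fin_num) /\
  norm_integral mu (fun x => h' x - s n x) @[n --> \oo] --> 0.
Proof.
move=> mN N0 hh' [_]; rewrite (_ : (fun n => _) =
    (fun n => (\int[mu]_x (rnorm (h' x - s n x))%:E)%E)); last first.
  apply/funext => n; apply: (eq_integral_off_null mN N0) => x Nx.
  by rewrite hh'.
by move/fine_cvgP.
Qed.

(** The norm of h' is at most |h' - s_n| + |s_n|, where the first term has finite
    integral for n large and the simple function s_n is bounded. *)
Lemma bochner_integrable_modification (V : normedModType K) (h : T -> V) :
  bochner_integrable mu h ->
  exists N h', [/\ measurable N, mu N = 0%E, forall x, ~ N x -> h x = h' x &
    norm_integrable mu h'].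
Proof.
move=> [/strongly_measurable_modification[N [h' [mN N0 hh' lh']]] [s hs]].
exists N, h'; split => //.
have [fin _] := L1_approx_norm_integral mN N0 hh' hs.
have [n finn] := filter_ex fin.
have ls : limit_simple (s n) by apply: simple_limit_simple; case: hs.
have [_ isn] := simple_norm_integrable mu (proj1 hs n).
have ihs : mu.-integrable setT (EFin \o (fun x => rnorm (h' x - s n x))).
  apply/integrableP; split.
    by apply/measurable_EFinP; apply: limit_simple_rnorm; exact: limit_simpleB.
  under eq_integral do rewrite /= ger0_norm ?rnorm_ge0//.
  by rewrite -ge0_fin_numE// integral_ge0// => x _; rewrite lee_fin rnorm_ge0.
apply: (@norm_integrable_le _ _ _ _ _ _ _
    (fun x => rnorm (h' x - s n x) + rnorm (s n x))) => //.
  by apply: eq_integrable (integrableD measurableT ihs isn) => // x _.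
by move=> x; rewrite -{1}(subrK (s n x) (h' x)) ler_rnormD.
Qed.

End modification.

(** * Evaluating Bochner integrals in the dual *)

Section bochner_evaluation.
Context (R : realType) (b : base_field) d (T : measurableType d).
Local Notation K := (field_of R b).
Variables (mu : {finite_measure set T -> \bar R}) (X : normedModType K).

Lemma norm_integrable_eval (g : T -> dual X) (x : T -> X) (M : R) :
  norm_integrable mu g -> limit_simple x -> (forall w, rnorm (x w) <= M) ->
  norm_integrable mu (fun w => g w (x w) : K^o).
Proof.
move=> [lg ig] lx xM; apply: (@norm_integrable_le _ _ _ _ _ _ _
    (fun w => M * rnorm (g w))).
- apply: (limit_simple_op (op := fun (p : dual X) u => p u : K^o)) => // p u q v.
  exact: cvg_dual_eval.
- exact: integrableZ_EFin.
- move=> w; apply: le_trans (ler_dual _ _) _; rewrite mulrC ler_wpM2r//.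
  exact: rnorm_ge0.
Qed.

Lemma norm_integrable_eval_cst (g : T -> dual X) (x : X) :
  norm_integrable mu g -> norm_integrable mu (fun w => g w x : K^o).
Proof.
move=> ig; apply: (@norm_integrable_eval g (cst x) (rnorm x)) => //.
exact/simple_limit_simple/simple_fun_cst.
Qed.

Lemma simple_int_eval E (s : T -> dual X) (x : X) : measurable E ->
  simple_fun s -> simple_int mu E s x = scalar_int mu E (fun w => s w x : K^o).
Proof.
move=> mE ss; have [fs _] := ss.
transitivity (scalar_int mu E (fun w => s w x * 1)); last first.
  by apply: eq_scalar_int => w _; rewrite mulr1.
rewrite (@scalar_int_simple _ _ _ _ _ _ _ _ (fun p : dual X => p x))//; last first.
  exact: scalar_integrable_cst1.
rewrite /simple_int !fsbig_finite//= dual_sumE; apply: eq_bigr => p _.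
rewrite scalar_int_cst1; last by apply: measurableI => //; exact: simple_fun_preimage.
by rewrite mulrC.
Qed.

Variables (h h' : T -> dual X) (N : set T).
Hypotheses (mN : measurable N) (N0 : mu N = 0%E).
Hypotheses (hh' : forall x, ~ N x -> h x = h' x) (ih' : norm_integrable mu h').

(** The limit is constructed as the bounded functional x |-> \int_E h'(w)(x);
    evaluated at x, its difference with the simple integral of s_n is
    \int_E (h' - s_n)(w)(x), at most 2 |x| \int |h' - s_n|. *)
Lemma simple_int_cvg E : measurable E ->
  exists p : dual X, (forall x, p x = scalar_int mu E (fun w => h' w x : K^o)) /\
    forall s, L1_approx mu h s -> simple_int mu E (s n) @[n --> \oo] --> p.
Proof.
move=> mE; have int_eval x : scalar_integrable mu E (fun w => h' w x : K^o).
  by apply: norm_integrable_scalar => //; exact: norm_integrable_eval_cst.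
have int_le (g : T -> dual X) x : norm_integrable mu g ->
    rnorm (scalar_int mu E (fun w => g w x : K^o)) <=
    2 * norm_integral mu g * rnorm x.
  move=> ig; apply: le_trans (rnorm_scalar_int_le mE _) _.
    exact: norm_integrable_eval_cst.
  rewrite -mulrA ler_pM2l// mulrC; apply: norm_integral_le => //.
    exact: norm_integrable_eval_cst.
  by move=> w; rewrite mulrC; exact: ler_dual.
have [||p pE] := @bounded_linear_dual _ _ X
    (fun x => scalar_int mu E (fun w => h' w x : K^o)) (2 * norm_integral mu h').
- move=> a u v; rewrite -scalar_intZ// -scalar_intD//; last exact: scalar_integrableZ.
  by apply: eq_scalar_int => w _; rewrite linearP.
- by move=> x; exact: int_le.
exists p; split => // s hs; have [_ s0] := L1_approx_norm_integral mN N0 hh' hs.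
have ss n : simple_fun (s n) by case: hs.
apply: (@cvg_rnorm_le _ _ _ _ _ _ _
    (fun n => 2 * norm_integral mu (fun x => h' x - s n x))).
  apply: nearW => n; apply: dual_rnorm_le.
    by rewrite mulr_ge0// norm_integral_ge0.
  move=> x; have -> : (p - simple_int mu E (s n)) x =
      scalar_int mu E (fun w => (h' w - s n w) x : K^o).
    rewrite -[LHS]/(p x - simple_int mu E (s n) x) pE simple_int_eval//.
    rewrite -mulN1r -scalar_intZ// -?scalar_intD//.
    - by apply: eq_scalar_int => w _; rewrite mulN1r.
    - apply: scalar_integrableZ => //; apply: norm_integrable_scalar => //.
      by apply: norm_integrable_eval_cst; exact: simple_norm_integrable.
    - apply: norm_integrable_scalar => //.
      by apply: norm_integrable_eval_cst; exact: simple_norm_integrable.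
  by apply: int_le; apply: norm_integrableB => //; exact: simple_norm_integrable.
by rewrite -[X in _ --> X](mulr0 2); exact: cvgMl_tmp.
Qed.

(** All L1 approximations lead to the same limit by [simple_int_cvg], which
    identifies the limit selected in the Bochner integral. *)
Lemma bochner_int_eval E x : measurable E -> (exists s, L1_approx mu h s) ->
  bochner_int mu E h x = scalar_int mu E (fun w => h' w x : K^o).
Proof.
move=> mE [s hs]; have [p [pE sp]] := simple_int_cvg mE.
rewrite /bochner_int (xget_unique _ (x := p)) ?pE//.
  by exists s => //; exact: sp.
move=> q [t ht tq]; exact: cvg_unique (sp _ ht).
Qed.

End bochner_evaluation.

(** * Continuous functions on a compact space as uniform limits *)

Section compact_approximation.
Context (R : realType) (b : base_field).
Local Notation K := (field_of R b).
Variables (Omega : ptopologicalType) (Omega_compact : compact [set: Omega]).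
Variable V : normedModType K.

Lemma continuous_rnorm_dist (f : Omega -> V) v : continuous f ->
  continuous (fun w => rnorm (f w - v)).
Proof.
move=> cf w; apply: cvg_rnorm; apply: cvgB; [exact: cf|exact: cvg_cst].
Qed.

Lemma open_rnorm_dist (f : Omega -> V) v (e : R) : continuous f ->
  open [set w | rnorm (f w - v) < e].
Proof.
move=> cf; have := @open_comp _ _ (fun w => rnorm (f w - v)) [set x | x < e].
apply; last exact: open_lt.
by move=> w _; exact: continuous_rnorm_dist.
Qed.

(** Compactness, applied to the preimages of the balls of radius e. *)
Lemma finite_net (f : Omega -> V) (e : R) : continuous f -> 0 < e ->
  exists r : seq Omega, forall w, exists2 v, v \in r & rnorm (f w - f v) < e.
Proof.
move=> cf e0; move: Omega_compact; rewrite compact_cover => /(_ Omega setT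
  (fun v => [set w | rnorm (f w - f v) < e])) [||D _ covD].
- by move=> v _; exact: open_rnorm_dist.
- by move=> w _; exists w => //=; rewrite subrr rnorm0.
by exists (finmap.enum_fset D) => w; have [v vD ?] := covD w I; exists v.
Qed.

Lemma measurable_open (A : set Omega) : open A -> measurable (A : set (borel Omega)).
Proof. by move=> oA; exact: sub_sigma_algebra. Qed.

(** The finite net gives finitely many open sets covering the space; s takes the
    value f(v) for the first v of the net whose open set contains the point. *)
Lemma uniform_simple (f : Omega -> V) (e : R) : continuous f -> 0 < e ->
  exists2 s : borel Omega -> V, simple_fun s & forall w, rnorm (f w - s w) < e.
Proof.
move=> cf e0; have [r rP] := finite_net cf e0.
suff [s ss sP] : exists2 s : borel Omega -> V, simple_fun s &
    forall w, (exists2 v, v \in r & rnorm (f w - f v) < e) -> rnorm (f w - s w) < e.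
  by exists s => // w; exact: sP.
elim: r {rP} => [|v r [s ss sP]].
  by exists (fun=> 0); [exact: simple_fun_cst|move=> w []].
pose A : set (borel Omega) := [set w | rnorm (f w - f v) < e].
have mA : measurable A by apply: measurable_open; exact: open_rnorm_dist.
exists (fun w => (if w \in A then f v else 0) + (if w \in ~` A then s w else 0)).
  apply: (simple_fun_op (fun x y : V => x + y)).
    by apply: (simple_fun_patch mA); exact: simple_fun_cst.
  by apply: simple_fun_patch => //; exact: measurableC.
move=> w wP; rewrite in_setC; have [/set_mem Aw|nAw] /= := boolP (w \in A).
  by rewrite addr0.
rewrite add0r; apply: sP; have [u] := wP; rewrite inE => /predU1P[->|ur] fwu.
  by move: nAw; rewrite notin_setE => /(_ fwu).
by exists u.
Qed.

Lemma uniform_simple_seq (f : Omega -> V) : continuous f ->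
  exists2 s : nat -> borel Omega -> V, forall n, simple_fun (s n) &
    forall n w, rnorm (f w - s n w) < n.+1%:R^-1.
Proof.
move=> cf; have H n : exists s : borel Omega -> V,
    simple_fun s /\ forall w, rnorm (f w - s w) < n.+1%:R^-1.
  by have [//||s ss sP] := @uniform_simple f n.+1%:R^-1; [|exists s].
have [s sP] := choice H.
by exists s => n; have [] := sP n.
Qed.

Lemma cvg_harmonic_lt (e : R) : 0 < e -> \forall n \near \oo, n.+1%:R^-1 < e.
Proof.
move=> e0; have /cvgrPdist_lt/(_ e e0) := @cvg_harmonic R.
by apply: filterS => n; rewrite sub0r normrN; apply: le_lt_trans; exact: ler_norm.
Qed.

Lemma uniform_cvg_pointwise (f : Omega -> V) (s : nat -> borel Omega -> V) :
  (forall n w, rnorm (f w - s n w) < n.+1%:R^-1) ->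
  forall w, s n w @[n --> \oo] --> f w.
Proof.
move=> sf w; apply/cvg_rnormP => e /cvg_harmonic_lt.
by apply: filterS => n; exact: lt_trans.
Qed.

Lemma continuous_limit_simple (f : Omega -> V) : continuous f ->
  limit_simple (f : borel Omega -> V).
Proof.
by move=> /uniform_simple_seq[s ss /uniform_cvg_pointwise sf]; exists s.
Qed.

End compact_approximation.

Lemma uniform_cvgP (R : realType) (b : base_field) (T : choiceType)
    (V : normedModType (field_of R b)) (s : nat -> T -> V) (f : T -> V) :
  {uniform, s @ \oo --> f} <->
  forall e : R, 0 < e -> \forall n \near \oo, forall x, rnorm (f x - s n x) < e.
Proof.
split=> [sf e e0|sf P].
  apply: (sf [set g : T -> V | forall x, rnorm (f x - g x) < e]).
  apply/uniform_nbhs; exists [set xy : V * V | rnorm (xy.1 - xy.2) < e]; split.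
    rewrite -entourage_from_ballE; exists (ofR b e).
      by rewrite /= -(ofR0 R b) ltr_ofR.
    by move=> [x y] /=; rewrite -ball_normE /= rnormE ltr_ofR.
  by move=> g /= gP x; exact: gP.
move=> /uniform_nbhs[E [entE EP]].
move: entE; rewrite -entourage_from_ballE => -[e /= e0 eE].
have eK : e = ofR b (reK e) by rewrite -[in LHS](gtr0_norm e0) normK_ofR gtr0_norm.
have : \forall n \near \oo, forall x, rnorm (f x - s n x) < reK e.
  by apply: sf; rewrite -(ltr_ofR b) -eK ofR0.
apply: filterS => n nP; apply: EP => x _; apply: eE => /=.
by rewrite -ball_normE /= rnormE eK ltr_ofR.
Qed.

(** * Integration against a measure with a density *)

Section int_against.
Context (R : realType) (b : base_field) d (T : measurableType d).
Local Notation K := (field_of R b).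
Variable mu : {finite_measure set T -> \bar R}.

Lemma norm_integrable_mul (f g : T -> K^o) (M : R) : norm_integrable mu g ->
  limit_simple f -> (forall x, rnorm (f x) <= M) ->
  norm_integrable mu (fun x => f x * g x).
Proof.
move=> [lg ig] lf fM; apply: (@norm_integrable_le _ _ _ _ _ _ _
    (fun w => M * rnorm (g w))).
- apply: (limit_simple_op (op := fun u v : K^o => u * v : K^o)) => // u v x y.
  exact: cvgM.
- exact: integrableZ_EFin.
- by move=> w; rewrite rnormM ler_wpM2r// rnorm_ge0.
Qed.

(** For simple s the integral against nu is \int s g, and
    |\int f g - \int s g| <= 2 sup|f - s| \int |g|; so every uniform simple
    approximation of f gives the same limit. *)
Lemma int_against_density (nu : set T -> K^o) (f g : T -> K^o) (M : R) :
  norm_integrable mu g -> limit_simple f -> (forall x, rnorm (f x) <= M) ->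
  (forall E, measurable E -> nu E = scalar_int mu E g) ->
  (exists2 s : nat -> T -> K^o, forall n, simple_fun (s n) & {uniform, s @ \oo --> f}) ->
  int_against nu f = scalar_int mu setT (fun x => f x * g x).
Proof.
move=> ig lf fM nug [s0 ss0 s0f].
have cvg_int s : (forall n, simple_fun (s n)) -> {uniform, s @ \oo --> f} ->
    simple_int_against nu (s n) @[n --> \oo] --> scalar_int mu setT (fun x => f x * g x).
  move=> ss /uniform_cvgP sf; apply/cvg_rnormP => e e0.
  have G0 : 0 <= norm_integral mu g by exact: norm_integral_ge0.
  (* Adding 1 keeps the divisor positive when g vanishes almost everywhere. *)
  have c0 : 0 < 2 * norm_integral mu g + 1 by rewrite ltr_wpDl// mulr_ge0.
  have := sf _ (divr_gt0 e0 c0); apply: filterS => n sfn.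
  have fin A : measurable A -> scalar_integrable mu A g.
    by move=> mA; exact: norm_integrable_scalar.
  have [Ms sM] := simple_fun_bounded (ss n).
  have isg : norm_integrable mu (fun x => s n x * g x).
    by apply: (norm_integrable_mul ig _ sM); exact: simple_limit_simple.
  have ifg : norm_integrable mu (fun x => f x * g x).
    exact: (norm_integrable_mul ig lf fM).
  have -> : simple_int_against nu (s n) = scalar_int mu setT (fun x => s n x * g x).
    rewrite (@scalar_int_simple _ _ _ _ _ _ _ _ id)//; last exact: fin.
    apply: eq_fsbigr => c _; rewrite nug ?setTI//; exact: simple_fun_preimage.
  have -> : scalar_int mu setT (fun x => f x * g x) -
      scalar_int mu setT (fun x => s n x * g x) =
      scalar_int mu setT (fun x => f x * g x - s n x * g x).
    rewrite -mulN1r -scalar_intZ -?scalar_intD//.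
    - by apply: eq_scalar_int => w _; rewrite mulN1r.
    - exact: norm_integrable_scalar.
    - by apply: scalar_integrableZ => //; exact: norm_integrable_scalar.
    - exact: norm_integrable_scalar.
  apply: le_lt_trans (rnorm_scalar_int_le _ _) _ => //.
    exact: norm_integrableB.
  apply: (@le_lt_trans _ _ (2 * (e / (2 * norm_integral mu g + 1) * norm_integral mu g))).
    rewrite ler_pM2l//; apply: norm_integral_le => //; first exact: norm_integrableB.
    by move=> x; rewrite -mulrBl rnormM ler_wpM2r ?rnorm_ge0// ltW.
  by rewrite mulrCA mulrAC ltr_pdivrMr// ltr_pM2l// ltrDl.
rewrite /int_against (xget_unique _ (x := scalar_int mu setT (fun x => f x * g x)))//.
  by exists s0; split => //; exact: cvg_int.
move=> y [s [ss sf sy]]; exact: cvg_unique sy (cvg_int _ ss sf).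
Qed.

End int_against.

(** * Density of sums of elementary tensors *)

Section continuous_functions.
Context (R : realType) (b : base_field).
Local Notation K := (field_of R b).
Variables (Omega : ptopologicalType) (Omega_compact : compact [set: Omega]).
Variable X : normedModType K.
Local Notation C := (cspace Omega_compact X).

Lemma cspace_rnormE (f : C) : rnorm f = supnorm setT f.
Proof. exact: ofRK. Qed.

Lemma ler_cspace (f : C) w : rnorm (f w) <= rnorm f.
Proof. by rewrite cspace_rnormE; apply: ler_supnorm => //; exact: cspace_bounded. Qed.

Lemma cspace_rnorm_le (f : C) (M : R) : 0 <= M ->
  (forall w, rnorm (f w) <= M) -> rnorm f <= M.
Proof. by move=> M0 fM; rewrite cspace_rnormE; apply: supnorm_le. Qed.

Lemma cspace_sumE (I : Type) (r : seq I) (f : I -> C) w :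
  (\sum_(i <- r) f i) w = \sum_(i <- r) f i w.
Proof. by elim/big_rec2 : _ => // i _ g _ <-. Qed.

Lemma continuous_ofR (u : Omega -> R) : continuous u ->
  continuous (fun w => ofR b (u w) : K^o).
Proof.
move=> cu w; apply/cvg_rnormP => e e0.
have /cvgrPdist_lt/(_ e e0) := cu w; apply: filterS => t.
have -> : ofR b (u w) - ofR b (u t) = ofR b (u w - u t).
  by apply/eqP; rewrite subr_eq -ofRD subrK.
by rewrite [rnorm _]rnorm_ofR.
Qed.

Lemma ofR_sum (I : Type) (r : seq I) (u : I -> R) :
  ofR b (\sum_(i <- r) u i) = \sum_(i <- r) ofR b (u i).
Proof. by apply: big_morph; [exact: ofRD|exact: ofR0]. Qed.

(** The tents max(0, e - |f - f(v)|), for v in a finite net, have positive sum;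
    normalised, they form a partition of unity lam, and f - \sum lam_v f(v) is
    the convex combination of the f - f(v) that are smaller than e. *)
Lemma tensor_span_dense (f : C) (e : R) : 0 < e ->
  exists r : seq (X * cspace Omega_compact K^o),
    rnorm (f - \sum_(p <- r) tensor p.1 p.2) <= e.
Proof.
move=> e0; have cf := @cspace_continuous _ _ _ _ _ f.
have [r rP] := finite_net Omega_compact cf e0.
pose g v w := Num.max 0 (e - rnorm (f w - f v)).
have g0 v w : 0 <= g v w by rewrite le_max lexx.
have cg v : continuous (g v).
  move=> w; apply: (@continuous_max R Omega (cst 0)); first exact: cvg_cst.
  by apply: cvgB; [exact: cvg_cst|exact: continuous_rnorm_dist].
pose S w := \sum_(v <- r) g v w.
have S0 w : 0 < S w.
  have [v vr fwv] := rP w; rewrite /S (big_rem _ vr)/= ltr_pwDl ?sumr_ge0//.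
  by rewrite lt_max subr_gt0 fwv orbT.
have cS : continuous S.
  by apply: continuous_big => [|v _]; [exact: add_continuous|exact: cg].
have lamP v : (fun w => ofR b (g v w / S w) : K^o) \in @cspace_pred Omega K^o.
  apply/asboolP; apply: continuous_ofR => w; apply: cvgM; first exact: cg.
  by apply: cvgV; [rewrite gt_eqF|exact: cS].
pose lam v := Cspace Omega_compact (lamP v).
exists [seq (f v, lam v) | v <- r]; rewrite big_map /=.
apply: cspace_rnorm_le => [|w]; first exact: ltW.
have sum1 : \sum_(v <- r) lam v w = 1.
  by rewrite -ofR_sum -mulr_suml -/(S w) divff ?ofR1// gt_eqF.
have -> : (f - \sum_(v <- r) tensor (f v) (lam v)) w =
    \sum_(v <- r) lam v w *: (f w - f v).
  rewrite -[LHS]/(f w - (\sum_(v <- r) tensor (f v) (lam v)) w) cspace_sumE.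
  rewrite -[f w in LHS]scale1r -sum1 scaler_suml -sumrB.
  by apply: eq_bigr => v _; rewrite scalerBr.
apply: le_trans (ler_rnorm_sum _ _ _) _.
apply: (@le_trans _ _ (\sum_(v <- r) g v w / S w * e)).
  apply: ler_sum => v _; rewrite rnormZ.
  have -> : reK `|lam v w| = g v w / S w.
    by rewrite -[LHS]/(rnorm (lam v w)) [rnorm _]rnorm_ofR ger0_norm// divr_ge0// ltW.
  have [gv|] := eqVneq (g v w) 0; first by rewrite gv !mul0r.
  move=> gv; rewrite ler_wpM2l ?divr_ge0 ?(ltW (S0 w))//.
  have : 0 < g v w by rewrite lt_def gv g0.
  by rewrite lt_max ltxx /= subr_gt0 => /ltW.
by rewrite -!mulr_suml -/(S w) divff ?mul1r// gt_eqF.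
Qed.

End continuous_functions.

(** * Integral representation of the functional *)

Section representation.
Context (R : realType) (b : base_field).
Local Notation K := (field_of R b).
Variables (Omega : ptopologicalType) (Omega_compact : compact [set: Omega]).
Variable X : normedModType K.
Local Notation C := (cspace Omega_compact X).
Variable mu : {finite_measure set (borel Omega) -> \bar R}.
Variables (h h' : borel Omega -> dual X) (N : set (borel Omega)).
Hypotheses (mN : measurable N) (N0 : mu N = 0%E).
Hypotheses (hh' : forall w, ~ N w -> h w = h' w) (ih' : norm_integrable mu h').

Lemma norm_integrable_pairing (f : C) :
  norm_integrable mu (fun w : borel Omega => h' w (f w) : K^o).
Proof.
apply: (norm_integrable_eval (M := rnorm f)) => //; last exact: ler_cspace.
apply: (continuous_limit_simple Omega_compact); exact: cspace_continuous.
Qed.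

Lemma scalar_int_modification (f : C) :
  scalar_int mu setT (fun w : borel Omega => h w (f w)) =
  scalar_int mu setT (fun w : borel Omega => h' w (f w)).
Proof.
by rewrite /scalar_int; congr (mkK _ (fine _) (fine _));
  apply: (eq_integral_off_null mN N0) => w Nw; rewrite hh'.
Qed.

(** If t_n approximates f uniformly within 1/(n+1) and u_n approximates h in L1,
    then u_n(t_n) is simple and |h(f) - u_n(t_n)| is at most
    |h - u_n| |t_n| + |h| |f - t_n|, with |t_n| <= sup|f| + 1. *)
Lemma bochner_integrable_pairing (f : C) : bochner_integrable mu h ->
  bochner_integrable mu (fun w : borel Omega => h w (f w) : K^o).
Proof.
have cf := @cspace_continuous _ _ _ _ _ f.
have [t st tf] := uniform_simple_seq Omega_compact cf.
have tf_cvg := uniform_cvg_pointwise tf.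
move=> [[s [ss sh]] [u hu]]; have su n : simple_fun (u n) by case: hu.
have ev (p : borel Omega -> dual X) (q : borel Omega -> X) :
    simple_fun p -> simple_fun q -> simple_fun (fun w : borel Omega => p w (q w) : K^o).
  exact: (simple_fun_op (fun (p : dual X) x => p x : K^o)).
split.
  exists (fun n w => s n w (t n w)); split; first by move=> n; exact: ev.
  by apply: filterS sh => w shw; exact: cvg_dual_eval.
exists (fun n w => u n w (t n w)); split; first by move=> n; exact: ev.
have [_ u0] := L1_approx_norm_integral mN N0 hh' hu.
rewrite (_ : (fun n => _) = (fun n => (norm_integral mu
    (fun w : borel Omega => h' w (f w) - u n w (t n w) : K^o))%:E)); last first.
  apply/funext => n; rewrite /norm_integral /Rintegral fineK.
    apply: (eq_integral_off_null mN N0) => w Nw; by rewrite hh'.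
  apply: integrable_fin_num => //.
  have [//] := norm_integrableB (norm_integrable_pairing f)
    (simple_norm_integrable mu (ev _ _ (su n) (st n))).
apply/fine_cvgP; split; first exact: nearW.
pose D n := norm_integral mu (fun w => h' w - u n w).
pose G := norm_integral mu h'.
have le n : norm_integral mu (fun w : borel Omega => h' w (f w) - u n w (t n w) : K^o)
    <= (rnorm f + 1) * D n + n.+1%:R^-1 * G.
  apply: norm_integral_leD => //.
  - by apply: norm_integrableB (norm_integrable_pairing f) _;
      exact/simple_norm_integrable/ev.
  - by apply: norm_integrableB => //; exact: simple_norm_integrable.
  move=> w.
  have -> : h' w (f w) - u n w (t n w) =
      (h' w - u n w) (t n w) + h' w (f w - t n w).
    rewrite linearB/= -[X in _ = X + _]/(h' w (t n w) - u n w (t n w)).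
    by rewrite [RHS]addrC addrA subrK.
  apply: le_trans (ler_rnormD _ _) _; apply: lerD.
    apply: le_trans (ler_dual _ _) _; rewrite mulrC ler_wpM2r ?rnorm_ge0//.
    rewrite -[t n w](subrK (f w)) addrC; apply: le_trans (ler_rnormD _ _) _.
    apply: lerD; first exact: ler_cspace.
    rewrite rnorm_distC; apply: le_trans (ltW (tf n w)) _.
    by rewrite invf_le1 ?ltr0n// ler1n.
  apply: le_trans (ler_dual _ _) _; rewrite mulrC ler_wpM2r ?rnorm_ge0//.
  exact: ltW.
apply: (@squeeze_cvgr _ _ _ _ (cst 0) (fun n => (rnorm f + 1) * D n + n.+1%:R^-1 * G)).
- by apply: nearW => n; rewrite le norm_integral_ge0.
- exact: cvg_cst.
- rewrite -[X in _ --> X](addr0 0) -[X in _ --> X + _](mulr0 (rnorm f + 1)).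
  rewrite -[X in _ --> _ + X](mul0r G).
  by apply: cvgD; apply: cvgM => //; try exact: cvg_cst; exact: cvg_harmonic.
Qed.

Hypothesis F_int : forall E (x : X), measurable E ->
  bochner_int mu E h x = scalar_int mu E (fun w : borel Omega => h' w x : K^o).
Variables (F : set (borel Omega) -> dual X) (phi : dual C).
Hypothesis F_h : forall E, measurable E -> F E = bochner_int mu E h.
Hypothesis F_phi : forall (x : X) (f : cspace Omega_compact K^o),
  phi (tensor x f) = int_against (tensor_measure x F) f.

(** The scalar measure E |-> F E x has density w |-> h'(w)(x). *)
Lemma functional_tensor x (f : cspace Omega_compact K^o) :
  phi (tensor x f) = scalar_int mu setT
    (fun w : borel Omega => h' w (tensor x f w) : K^o).
Proof.
have cf := @cspace_continuous _ _ _ _ _ f.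
rewrite F_phi (@int_against_density _ _ _ _ mu _ _
    (fun w : borel Omega => h' w x : K^o) (rnorm f)).
- by apply: eq_scalar_int => w _; rewrite linearZ.
- exact: norm_integrable_eval_cst.
- exact: (continuous_limit_simple Omega_compact).
- exact: ler_cspace.
- by move=> E mE; rewrite /tensor_measure F_h// F_int.
have [s ss sf] := uniform_simple_seq Omega_compact cf.
exists s => //; apply/uniform_cvgP => e /cvg_harmonic_lt.
by apply: filterS => n ne w; apply: lt_trans ne; exact: sf.
Qed.

(** Both sides agree on sums of elementary tensors and are bounded for the sup
    norm, with constants |phi| and 2 \int |h'|. *)
Lemma functional_integral (f : C) :
  phi f = scalar_int mu setT (fun w : borel Omega => h' w (f w) : K^o).
Proof.
pose I (g : C) := scalar_int mu setT (fun w : borel Omega => h' w (g w) : K^o).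
have integrable_pairing (g : C) :
    scalar_integrable mu setT (fun w : borel Omega => h' w (g w) : K^o).
  by apply: norm_integrable_scalar => //; exact: norm_integrable_pairing.
have ID (g1 g2 : C) : I (g1 + g2) = I g1 + I g2.
  rewrite -scalar_intD//; apply: eq_scalar_int => w _.
  by rewrite -linearD.
have I0 : I 0 = 0.
  rewrite -[RHS](scalar_int0 b mu setT); apply: eq_scalar_int => w _.
  exact: linear0.
have span (r : seq (X * cspace Omega_compact K^o)) :
    phi (\sum_(p <- r) tensor p.1 p.2) = I (\sum_(p <- r) tensor p.1 p.2).
  elim: r => [|p r IH]; first by rewrite big_nil linear0 I0.
  by rewrite big_cons linearD/= ID -IH functional_tensor.
pose M := rnorm phi + 2 * norm_integral mu h'.
have M0 : 0 <= M.
  by rewrite addr_ge0 ?rnorm_ge0// mulr_ge0// norm_integral_ge0.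
(* The distance of the two sides is at most e for every e > 0; the divisor M + 1
   below is positive even if M = 0. *)
apply/eqP; rewrite -subr_eq0; apply/eqP; apply: (@rnorm_eq0 R b K^o).
apply/eqP; rewrite eq_le rnorm_ge0 andbT; apply/ler_addgt0Pr => e e0.
rewrite add0r.
have c0 : 0 < M + 1 by rewrite ltr_wpDl.
have [r] := tensor_span_dense f (divr_gt0 e0 c0).
set g := \sum_(p <- r) _ => fg.
have -> : phi f - I f = phi (f - g) - I (f - g).
  have If : I f = I (f - g) + I g by rewrite -ID subrK.
  by rewrite If linearB/= span opprD addrA addrAC -addrA.
apply: le_trans (ler_rnormD _ _) _; rewrite rnormN.
apply: (@le_trans _ _ (M * rnorm (f - g))).
  rewrite mulrDl; apply: lerD; first exact: ler_dual.
  apply: le_trans (rnorm_scalar_int_le measurableT (norm_integrable_pairing _)) _.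
  rewrite -mulrA ler_pM2l// mulrC; apply: norm_integral_le => //.
    exact: norm_integrable_pairing.
  move=> w; apply: le_trans (ler_dual _ _) _; rewrite mulrC ler_wpM2r ?rnorm_ge0//.
  exact: ler_cspace.
apply: le_trans (ler_wpM2l M0 fg) _.
by rewrite mulrA ler_pdivrMr// mulrC ler_pM2l// lerDl.
Qed.

End representation.

Theorem lemma2p3 (R : realType) (b : base_field) (Omega : ptopologicalType)
    (Omega_compact : compact [set: Omega]) (Omega_hausdorff : hausdorff_space Omega)
    (Omega_infinite : infinite_set [set: Omega])
    (X : completeNormedModType (field_of R b)) (X_RNP : RNP (dual X))
    (phi : dual (cspace Omega_compact X)) (F : set (borel Omega) -> dual X)
    (F_phi : represents F phi)
    (h : borel Omega -> dual X) (F_h : has_density F h (measure_variation F))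
    (f : cspace Omega_compact X) :
  bochner_integrable (measure_variation F) (fun w : borel Omega => h w (f w)) /\
  phi f = scalar_int (measure_variation F) setT (fun w : borel Omega => h w (f w)).
Proof.
have [[vF Foo _] phiF] := F_phi.
have [mu muE] := measure_variation_finite_measure vF Foo.
rewrite muE in F_h *; have [bh Fh] := F_h.
have [N [h' [mN N0 hh' ih']]] := bochner_integrable_modification bh.
split; first exact: (bochner_integrable_pairing mN N0 hh' ih').
rewrite (scalar_int_modification mN N0 hh').
apply: (functional_integral ih' _ Fh phiF) => E x mE.
by apply: (bochner_int_eval mN N0 hh' ih') => //; have [] := bh.
Qed.
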